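(* Fix $d\ge1$ and let $\beta,y_1,y_2,\dots$ be indeterminates. For all partitions $\mu\subseteq\lambda$ with $\ell(\lambda)\le d$ (set $\lambda_i=0$ for $i>\ell(\lambda)$), $$\sum_{T\in\operatorname{SIT}(\lambda/\mu)}\prod_{k=1}^{m(T)}\left(\left[\prod_{i=1}^d\frac{1+\beta\,y_{\nu_i(T_{<k})+d-i+1}}{1+\beta\,y_{\lambda_i+d-i+1}}\right]-1\right)^{-1}=\sum_{D\in\mathcal D(\lambda/\mu)}\beta^{|D|-|\lambda|}\prod_{(i,j)\in\lambda\setminus D}\frac{\beta\,y_{\lambda_i+d-i+1}+1}{y_{d+j-\lambda'_j}-y_{\lambda_i+d+1-i}}$$ as rational functions.
   Context: Partitions are identified with Young diagrams $\{(i,j):1\le j\le\lambda_i\}$ (English convention); $\lambda'$ is the conjugate; $|\cdot|$ counts cells. A standard increasing tableau of shape $\lambda/\mu$ is a filling $T$ of the cells of $\lambda/\mu$ by positive integers, strictly increasing along rows and down columns, with set of entries $\{1,\dots,m\}$ for some $m=m(T)$; $\operatorname{SIT}(\lambda/\mu)$ is their set. $\nu(T_{<k})$ is the partition whose diagram is $\mu$ together with the cells of $\lambda/\mu$ with entry $<k$, with parts $\nu_i(T_{<k})$. Generalized excited diagrams: for $S\subseteq\lambda$, a cell $(i,j)\in S$ is active if $(i+1,j),(i,j+1),(i+1,j+1)\in\lambda\setminus S$; for active $(i,j)$ the type I move replaces $(i,j)$ by $(i+1,j+1)$ and the type II move adds $(i+1,j+1)$ to $S$. $\mathcal D(\lambda/\mu)$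 is the set of subsets of $\lambda$ obtainable from the diagram of $\mu$ by sequences of type I and II moves. *)

(* Defs.v *)
From HB Require Import structures.
From mathcomp Require Import all_boot all_order all_algebra.
From mathcomp Require Import fraction.
From mathcomp Require Import mpoly.
Set Implicit Arguments. Unset Strict Implicit. Unset Printing Implicit Defensive.
Import Order.TTheory GRing.Theory Num.Theory.

Definition is_partition (l : seq nat) : bool :=
  sorted geq l && all (fun x => 0 < x) l.

Definition part (l : seq nat) (i : nat) : nat := nth 0 l i.-1.

Definition conj_part (l : seq nat) (j : nat) : nat := count (fun x => j <= x) l.

Definition psize (l : seq nat) : nat := sumn l.

Definition in_diag (l : seq nat) (c : nat * nat) : bool :=
  [&& 1 <= c.1, 1 <= c.2 & c.2 <= part l c.1].

Definition subpart (mu la : seq nat) : Prop := forall i, part mu i <= part la i.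

(* Cells of the box [1..d] x [1..lambda_1]; the ordinal pair (a,b) encodes the
   cell (a+1, b+1).  When length lambda <= d every cell of lambda is here. *)
Definition Cell (d : nat) (la : seq nat) : finType := ('I_d * 'I_(part la 1))%type.

Definition cellpos d la (x : Cell d la) : nat * nat := ((x.1 : nat).+1, (x.2 : nat).+1).

Definition diag_set d la (p : seq nat) : {set Cell d la} :=
  [set x | in_diag p (cellpos x)].

Definition in_skew (la mu : seq nat) (c : nat * nat) : bool :=
  in_diag la c && ~~ in_diag mu c.

Section Excited.
Variables (d : nat) (la : seq nat).

Definition inS (S : {set Cell d la}) (c : nat * nat) : bool :=
  [exists x in S, cellpos x == c].

Definition active (S : {set Cell d la}) (x : Cell d la) : bool :=
  let: (i, j) := cellpos x in
  [&& x \in S,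
      in_diag la (i.+1, j) && ~~ inS S (i.+1, j),
      in_diag la (i, j.+1) && ~~ inS S (i, j.+1) &
      in_diag la (i.+1, j.+1) && ~~ inS S (i.+1, j.+1)].

Definition exc_move : rel {set Cell d la} := fun S S' =>
  [exists x, active S x &&
     [exists y : Cell d la,
        (cellpos y == ((cellpos x).1.+1, (cellpos x).2.+1)) &&
        ((S' == (S :\ x) :|: [set y]) || (S' == S :|: [set y]))]].

Definition excited (mu : seq nat) : {set {set Cell d la}} :=
  [set S | connect exc_move (diag_set d la mu) S].
End Excited.

(* Entries are stored in 'I_(#|Cell|.+1) (big enough since m(T) <= #cells);
   cells outside la/mu carry the dummy value 0. *)
Definition Bnd d la := #|Cell d la|.+1.

Definition Tab d la := {ffun Cell d la -> 'I_(Bnd d la)}.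

Definition mT d la (T : Tab d la) : nat := \max_(x : Cell d la) (T x : nat).

Definition is_SIT d la (mu : seq nat) (T : Tab d la) : bool :=
  [&& [forall x, (in_skew la mu (cellpos x) ==> (0 < T x))
              && (~~ in_skew la mu (cellpos x) ==> (T x == 0 :> nat))],
      [forall x, forall y,
         [&& in_skew la mu (cellpos x), in_skew la mu (cellpos y),
             (cellpos x).1 == (cellpos y).1 & (cellpos x).2 < (cellpos y).2]
         ==> (T x < T y)],
      [forall x, forall y,
         [&& in_skew la mu (cellpos x), in_skew la mu (cellpos y),
             (cellpos x).2 == (cellpos y).2 & (cellpos x).1 < (cellpos y).1]
         ==> (T x < T y)] &
      [forall k : 'I_(Bnd d la),
         ((1 <= k) && (k <= mT T)) ==>
         [exists x, in_skew la mu (cellpos x) && (T x == k)]]].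

Definition nuT d la (mu : seq nat) (T : Tab d la) (k i : nat) : nat :=
  #|[set x : Cell d la | ((cellpos x).1 == i) &&
       (in_diag mu (cellpos x) || (in_skew la mu (cellpos x) && (T x < k)))]|.

Definition RF (n : nat) := {fraction {mpoly rat[n]}}.

(* variable number k: k = 0 is beta, k >= 1 is y_k (0 if out of range) *)
Definition var (n : nat) (k : nat) : {mpoly rat[n]} :=
  if insub k is Some i then 'X_i else 0.

Definition yv (n : nat) (k : nat) : RF n := tofrac (var n k).
Definition betav (n : nat) : RF n := tofrac (var n 0).

(* Main.v *)
(* Both sides depend on mu only through its diagram M, an order ideal of the
   box [d] x [la_1].  Adding cells by the 0-Hecke action (a generator adds the
   addable cell of its content, fixes M if there is a removable one, and kills
   M otherwise), the generalized excited diagrams of la/mu are exactly the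
   subsets D of la whose reading word, applied to the empty diagram, gives mu.
   With c_m = 1 + beta y_m every factor on the right is 1/p, where
   p = c_col / c_row - 1, so the right-hand side is, up to a constant, the
   coefficient Z(mu) of mu in a product of operators 1 + p T over the cells of
   la.  Intertwining T with the operator summing over rook strips gives the
   Chevalley rule
     (w(mu) / w(la)) Z(mu) = sum of Z(mu') over mu' / mu a rook strip,
   where w(mu) is the product of the c_(mu_i+d-i+1).  Removing the cells of
   entry 1 from an increasing tableau gives the same recursion on the left. *)

(* The Chevalley rule is proved by induction on the shape, removing its last cell in reading order.
   The obstacle is that the labels of rows and columns are read off the boundary path of the shape,
   so they would change as the shape shrinks. Removing a corner of content k only exchanges steps k
   and k+1 of that path: the labels can be frozen as functions of the row and of the column,
   provided the values of [c] at k and k+1 are exchanged and the induction ranges over all [c]. What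
   remains, for each ideal M, is an identity in two values of [c], according to whether M has an
   addable corner, a removable corner or no corner of content k.

   On the excited side, the two neighbours that an active cell x must miss are exactly the cells of
   adjacent content lying between x and its diagonal successor in reading order. When they are
   absent, the letter of x commutes up to the place of the successor; there it is moved (type I), or
   doubled by idempotence (type II).

   The recursions can be solved because the weight of a proper subideal differs from that of the
   full shape; such inequalities between rational functions are checked at beta = 1, y_k = k. *)
Require Import Defs.
From HB Require Import structures.
From mathcomp Require Import all_boot all_order all_algebra.
From mathcomp Require Import fraction zify ring.
From mathcomp Require Import mpoly perm.
Import Order.TTheory GRing.Theory Num.Theory.
Local Open Scope ring_scope.

Set Implicit Arguments.
Unset Strict Implicit.
Unset Printing Implicit Defensive.

(** * Order ideals of a box and the partial 0-Hecke action on them *)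

Section Ideals.
Variables d N : nat.
Notation cell := ('I_d * 'I_N)%type.
Implicit Types (x y z : cell) (M D S : {set cell}) (k : nat).

Definition below x y : bool := (x.1 <= y.1)%N && (x.2 <= y.2)%N.

Definition ideal M : Prop := forall x y, below x y -> y \in M -> x \in M.

Definition addable M z : bool :=
  (z \notin M) && [forall x, below x z && (x != z) ==> (x \in M)].

Definition removable M z : bool :=
  (z \in M) && [forall x, below z x && (x != z) ==> (x \notin M)].

(* The content of a cell, shifted by [d - 1] so as to be a natural number. *)
Definition kappa x : nat := (x.2 + (d - x.1.+1))%N.

Lemma cellP x y : reflect ((x.1 : nat) = y.1 /\ (x.2 : nat) = y.2) (x == y).
Proof.
apply: (iffP eqP) => [-> //|[h1 h2]].
by case: x y h1 h2 => [x1 x2] [y1 y2] /= /val_inj -> /val_inj ->.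
Qed.

Lemma addableP M z :
  reflect (z \notin M /\ forall x, below x z -> x != z -> x \in M) (addable M z).
Proof.
apply: (iffP andP) => -[zM h]; split=> //.
  by move=> x xz nxz; move/forallP/(_ x): h; rewrite xz nxz.
by apply/forallP=> x; apply/implyP=> /andP[]; apply: h.
Qed.

Lemma removableP M z :
  reflect (z \in M /\ forall x, below z x -> x != z -> x \notin M) (removable M z).
Proof.
apply: (iffP andP) => -[zM h]; split=> //.
  by move=> x xz nxz; move/forallP/(_ x): h; rewrite xz nxz.
by apply/forallP=> x; apply/implyP=> /andP[]; apply: h.
Qed.

Lemma kappa_below x y : kappa x = kappa y -> below x y \/ below y x.
Proof.
rewrite /kappa /below; have := ltn_ord x.1; have := ltn_ord y.1; lia.
Qed.

Lemma kappaP x y : (kappa x = kappa y) <-> (x.1 + y.2 = y.1 + x.2)%N.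
Proof.
by rewrite /kappa; have := ltn_ord x.1; have := ltn_ord y.1; split; lia.
Qed.

Lemma ex_cell (a b : nat) : (a < d)%N -> (b < N)%N ->
  exists x : cell, (x.1 : nat) = a /\ (x.2 : nat) = b.
Proof. by move=> ha hb; exists (Ordinal ha, Ordinal hb). Qed.

Lemma diag_between x y : kappa x = kappa y -> below x y -> x != y ->
  exists u l : cell,
    [/\ u.1.+1 = y.1 :> nat, u.2 = y.2, l.1 = y.1 & l.2.+1 = y.2 :> nat]
    /\ [/\ below x u, below x l, x != u & x != l].
Proof.
move=> /kappaP hk /andP[h1 h2] /cellP hne.
have [u [u1 u2]] : exists u : cell, (u.1 : nat) = y.1.-1 /\ (u.2 : nat) = y.2.
  by apply: ex_cell; have := ltn_ord y.1; have := ltn_ord y.2; lia.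
have [l [l1 l2]] : exists l : cell, (l.1 : nat) = y.1 /\ (l.2 : nat) = y.2.-1.
  by apply: ex_cell; have := ltn_ord y.1; have := ltn_ord y.2; lia.
exists u, l; split; split; rewrite /below; try lia.
- by apply: val_inj.
- by apply: val_inj.
- by apply/cellP; lia.
- by apply/cellP; lia.
Qed.

Lemma addable_uniq M y z : ideal M -> addable M y -> addable M z ->
  kappa y = kappa z -> y = z.
Proof.
move=> iM /addableP[yM hy] /addableP[zM hz] hk.
apply/eqP/negPn/negP=> nyz.
case: (kappa_below hk) => b.
  by move: yM; rewrite (hz _ b nyz).
by move: zM; rewrite (hy _ b) // eq_sym.
Qed.

Lemma removable_uniq M y z : ideal M -> removable M y -> removable M z ->
  kappa y = kappa z -> y = z.
Proof.
move=> iM /removableP[yM hy] /removableP[zM hz] hk.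
apply/eqP/negPn/negP=> nyz.
case: (kappa_below hk) => b.
  by move: (hy _ b); rewrite eq_sym nyz zM => /(_ isT).
by move: (hz _ b nyz); rewrite yM.
Qed.

(** If [z] lay strictly below [y] on a diagonal, the cell just above [y] would lie strictly between
    them: addability of [y] puts it in [M], removability of [z] keeps it out. With the two
    uniqueness lemmas, a diagonal carries at most one corner of an ideal, so [step] involves no
    choice. *)
Lemma addable_removableF M y z : ideal M -> addable M y -> removable M z ->
  kappa z = kappa y -> False.
Proof.
move=> iM /addableP[yM hy] /removableP[zM hz] hk.
have nzy : z != y by apply/eqP=> e; move: yM; rewrite -e zM.
case: (kappa_below hk) => b; last by move: yM; rewrite (iM _ _ b).
have [u [l [[u1 u2 _ _] [bu _ nu _]]]] := diag_between hk b nzy.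
have buy : below u y by rewrite /below u2 -u1; lia.
have nuy : u != y by apply/cellP; lia.
by move: (hz _ bu); rewrite eq_sym nu (hy _ buy nuy) => /(_ isT).
Qed.

Lemma ideal0 : ideal set0. Proof. by move=> x y _; rewrite inE. Qed.

Lemma ideal_addU M M' : ideal M -> M \subset M' ->
  M' \subset M :|: [set z | addable M z] -> ideal M'.
Proof.
move=> iM /subsetP sMM' /subsetP h x y bxy yM'.
move: (h _ yM'); rewrite !inE => /orP[yM|/addableP[yM hy]].
  by apply: sMM'; apply: iM bxy yM.
by have [->//|nxy] := eqVneq x y; apply: sMM'; apply: hy.
Qed.

Lemma ideal_add M z : ideal M -> addable M z -> ideal (z |: M).
Proof.
move=> iM az; apply: (ideal_addU iM); first exact: subsetUr.
apply/subsetP=> x; rewrite !inE => /orP[/eqP->|->//].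
by rewrite az orbT.
Qed.

Lemma ideal_rem M z : ideal M -> removable M z -> ideal (M :\ z).
Proof.
move=> iM /removableP[zM hz] x y bxy; rewrite !inE => /andP[nyz yM].
rewrite (iM _ _ bxy yM) andbT; apply/eqP=> xz.
by move: (hz y); rewrite -xz bxy xz nyz yM => /(_ isT isT).
Qed.

Lemma removable_add M z : ideal M -> addable M z -> removable (z |: M) z.
Proof.
move=> iM /addableP[zM hz]; apply/removableP; split; first by rewrite !inE eqxx.
move=> x bzx nxz; rewrite !inE (negPf nxz) /=; apply/negP=> xM.
by move: zM; rewrite (iM _ _ bzx xM).
Qed.

Lemma addable_rem M z : ideal M -> removable M z -> addable (M :\ z) z.
Proof.
move=> iM rz; apply/addableP; split; first by rewrite !inE eqxx.
move=> x bxz nxz; rewrite !inE nxz /=; apply: iM bxz _.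
by case/removableP: rz.
Qed.

Definition step k M : option {set cell} :=
  if [pick z | addable M z && (kappa z == k)] is Some z then Some (z |: M)
  else if [exists z, removable M z && (kappa z == k)] then Some M else None.

Variant step_spec k M : option {set cell} -> Prop :=
| StepAdd z of addable M z & kappa z = k : step_spec k M (Some (z |: M))
| StepRem z of removable M z & kappa z = k : step_spec k M (Some M)
| StepNone of (forall z, kappa z = k -> ~~ addable M z)
            & (forall z, kappa z = k -> ~~ removable M z) : step_spec k M None.

Lemma stepP k M : step_spec k M (step k M).
Proof.
rewrite /step; case: pickP => [z /andP[az /eqP kz]|h]; first exact: StepAdd az kz.
case: existsP => [[z /andP[rz /eqP kz]]|h']; first exact: StepRem rz kz.
apply: StepNone => z kz; apply/negP => hz.
  by have := h z; rewrite hz kz eqxx.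
by apply: h'; exists z; rewrite hz kz eqxx.
Qed.

Lemma step_add M z : ideal M -> addable M z -> step (kappa z) M = Some (z |: M).
Proof.
move=> iM az; case: stepP => [y ay ky|y ry ky|/(_ _ erefl)]; last by rewrite az.
  by rewrite (addable_uniq iM ay az ky).
by case: (addable_removableF iM az ry ky).
Qed.

Lemma step_rem M z : ideal M -> removable M z -> step (kappa z) M = Some M.
Proof.
move=> iM rz; case: stepP => [y ay ky|//|_ /(_ _ erefl)]; last by rewrite rz.
by case: (addable_removableF iM ay rz).
Qed.

Lemma step_none k M : (forall z, kappa z = k -> ~~ addable M z) ->
  (forall z, kappa z = k -> ~~ removable M z) -> step k M = None.
Proof.
move=> ha hr; case: stepP => // z hz /[dup] kz.
  by move/ha; rewrite hz.
by move/hr; rewrite hz.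
Qed.

Lemma step_ideal k M M' : ideal M -> step k M = Some M' -> ideal M'.
Proof.
by move=> iM; case: stepP => [z az _ [<-]|z _ _ [<-]|] //; apply: ideal_add.
Qed.

Lemma step_idem k M : ideal M -> obind (step k) (step k M) = step k M.
Proof.
move=> iM; case: (stepP k M) => [z az kz|z rz kz|//] /=; rewrite -kz step_rem //.
  exact: ideal_add.
exact: removable_add.
Qed.

Definition far (k l : nat) : bool := (k.+1 < l)%N || (l.+1 < k)%N.

(** Moving to a neighbouring cell changes the content by exactly one, so comparable cells on far
    diagonals are never neighbours. This is why corners on far diagonals do not affect each
    other. *)
Lemma far_between x y : below x y -> far (kappa x) (kappa y) ->
  exists w, [/\ below x w, below w y, w != x & w != y].
Proof.
rewrite /below /far /kappa => bxy f; have := ltn_ord x.1; have := ltn_ord y.1 => l1 l2.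
have [a|b] : (x.1 < y.1)%N \/ (x.2 < y.2)%N by lia.
  have [w [w1 w2]] : exists w : cell, (w.1 : nat) = x.1.+1 /\ (w.2 : nat) = x.2.
    by apply: ex_cell; have := ltn_ord y.1; have := ltn_ord x.2; lia.
  by exists w; split; try (by lia); apply/cellP; lia.
have [w [w1 w2]] : exists w : cell, (w.1 : nat) = x.1 /\ (w.2 : nat) = x.2.+1.
  by apply: ex_cell; have := ltn_ord x.1; have := ltn_ord y.2; lia.
by exists w; split; try (by lia); apply/cellP; lia.
Qed.

Lemma farC k l : far k l = far l k. Proof. by rewrite /far orbC. Qed.

Lemma far_neq x y : far (kappa x) (kappa y) -> x != y.
Proof. by apply: contraTneq => ->; rewrite /far; lia. Qed.

Lemma addable_far M z y : ideal M -> addable M z -> far (kappa z) (kappa y) ->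
  addable (z |: M) y = addable M y.
Proof.
move=> iM az f; have iM' := ideal_add iM az.
have nzy := far_neq f; case/addableP: (az) => zM hz.
apply/addableP/addableP => -[yM hy].
  move: yM; rewrite !inE eq_sym (negPf nzy) /= => yM; split=> // x bxy nxy.
  have := hy _ bxy nxy; rewrite !inE => /orP[/eqP xz|//].
  have [w [b1 b2 n1 n2]] : exists w, [/\ below z w, below w y, w != z & w != y].
    by apply: far_between; rewrite // -xz.
  have := hy _ b2 n2; rewrite !inE (negPf n1) /= => wM.
  by move: zM; rewrite (iM _ _ b1 wM).
split; first by rewrite !inE eq_sym (negPf nzy).
by move=> x bxy nxy; rewrite !inE hy // orbT.
Qed.

Lemma removable_far M z y : ideal M -> addable M z -> far (kappa z) (kappa y) ->
  removable (z |: M) y = removable M y.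
Proof.
move=> iM az f; have iM' := ideal_add iM az.
have nzy := far_neq f; case/addableP: (az) => zM hz.
apply/removableP/removableP => -[yM hy].
  move: yM; rewrite !inE eq_sym (negPf nzy) /= => yM; split=> // x byx nxy.
  by have := hy _ byx nxy; rewrite !inE negb_or => /andP[].
split=> [|x byx nxy]; first by rewrite !inE yM orbT.
rewrite !inE negb_or hy // andbT; apply/eqP=> xz.
have [w [b1 b2 n1 n2]] : exists w, [/\ below y w, below w z, w != y & w != z].
  by apply: far_between; rewrite -?xz // xz farC.
by move: (hy _ b1 n1); rewrite hz.
Qed.

Lemma step_addC M z l : ideal M -> addable M z -> far (kappa z) l ->
  step l (z |: M) = omap (fun M' => z |: M') (step l M).
Proof.
move=> iM az f; have iM' := ideal_add iM az.
case: (stepP l M) => [y ay ky|y ry ky|ha hr] /=.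
- by rewrite setUCA -ky step_add // addable_far // ky.
- by rewrite -ky step_rem // removable_far // ky.
- apply: step_none => y ky; first by rewrite addable_far ?ky ?ha.
  by rewrite removable_far ?ky ?hr.
Qed.

Lemma stepC k l M : ideal M -> far k l ->
  obind (step l) (step k M) = obind (step k) (step l M).
Proof.
move=> iM f; case: (stepP k M) => [z az <-|z rz kz|ha hr] in f * => /=.
- rewrite step_addC //; case: (stepP l M) => [y ay ky|y ry ky|//] in f * => /=.
    by rewrite step_add ?addable_far // ?ky ?[far l _]farC //; apply: ideal_add.
  by rewrite step_add.
- case: (stepP l M) => [y ay ky|y ry ky|//] in f * => /=.
    rewrite -kz step_rem //; first exact: ideal_add.
    by rewrite removable_far // ky kz farC.
  by rewrite -kz step_rem.
- case: (stepP l M) => [y ay ky|y ry ky|//] in f * => /=.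
    have f' : far (kappa y) k by rewrite ky farC.
    apply/esym/step_none => w kw; first by rewrite addable_far ?kw ?ha.
    by rewrite removable_far ?kw ?hr.
  by apply/esym/step_none.
Qed.

End Ideals.

(** * Reading words of sets of cells, and the effect of excited moves on them *)

Section Reading.
Variables d N : nat.
Notation cell := ('I_d * 'I_N)%type.
Implicit Types (x y z : cell) (M D S : {set cell}) (k : nat).

Definition rk x : nat := (x.1 * N + x.2)%N.

Lemma rk_ltP x y :
  (rk x < rk y)%N <-> (x.1 < y.1)%N \/ (x.1 : nat) = y.1 /\ (x.2 < y.2)%N.
Proof.
rewrite /rk; have := ltn_ord x.2; have := ltn_ord y.2; move: (x.1 : nat) (y.1 : nat).
move=> a b hy hx; split=> [|[h|[-> h]]]; [|nia|lia].
case: (ltngtP a b) => [|h|->]; [by left| nia |right; lia].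
Qed.

Lemma rk_inj : injective rk.
Proof.
move=> x y e; have := rk_ltP x y; have := rk_ltP y x; rewrite e ltnn => h1 h2.
by apply/eqP/cellP; lia.
Qed.

Lemma rk_below x y : below x y -> (rk x <= rk y)%N.
Proof. by case/andP=> h1 h2; rewrite leq_add // leq_mul. Qed.

(** Induction along the reading word: [x] carries its last letter. *)
Lemma last_ind (Q : {set cell} -> Prop) : Q set0 ->
  (forall x D, (forall y, y \in D -> (rk y < rk x)%N) -> Q D -> Q (x |: D)) ->
  forall D, Q D.
Proof.
move=> Q0 QS D; have [n] := ubnP #|D|; elim: n => // n IH in D *.
have [->|[x0 x0D]] := set_0Vmem D; first by [].
have [x xD hx] := arg_maxnP rk x0D.
rewrite ltnS -(setD1K xD) cardsU1 !inE eqxx add1n => hn.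
apply: QS; last exact: IH.
move=> y; rewrite !inE => /andP[nyx yD]; rewrite ltn_neqAle (inj_eq rk_inj) nyx.
exact: hx.
Qed.

Definition hecke D : option {set cell} :=
  foldl (fun o x => obind (step (kappa x)) o) (Some set0)
    (sort (relpre rk leq) (enum D)).

Lemma hecke0 : hecke set0 = Some set0.
Proof. by rewrite /hecke enum_set0. Qed.

Lemma heckeU1 x D : (forall y, y \in D -> (rk y < rk x)%N) ->
  hecke (x |: D) = obind (step (kappa x)) (hecke D).
Proof.
move=> hx; have tr : transitive (relpre rk leq) by move=> a b c; apply: leq_trans.
have to : total (relpre rk leq) by move=> a b; apply: leq_total.
have -> : hecke (x |: D) = foldl (fun o x => obind (step (kappa x)) o) (Some set0)
    (rcons (sort (relpre rk leq) (enum D)) x).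
  rewrite /hecke; congr foldl; apply: (sorted_eq tr) => //.
  - by move=> a b h; apply: rk_inj; apply: anti_leq.
  - exact: sort_sorted.
  - rewrite sorted_pairwise // pairwise_rcons -sorted_pairwise // sort_sorted // andbT.
    by apply/allP=> y; rewrite mem_sort mem_enum => /hx/ltnW.
  - rewrite perm_sort perm_sym; apply: uniq_perm.
    + rewrite rcons_uniq sort_uniq enum_uniq andbT mem_sort mem_enum.
      by apply/negP=> /hx; rewrite ltnn.
    + exact: enum_uniq.
    + by move=> y; rewrite mem_rcons inE mem_sort !mem_enum !inE.
by rewrite foldl_rcons.
Qed.

Lemma hecke_ideal D M : hecke D = Some M -> ideal M.
Proof.
elim/last_ind: D M => [|x D hx IH] M; first by rewrite hecke0 => -[<-]; apply: ideal0.
rewrite heckeU1 //; case: (hecke D) IH => //= M' /(_ _ erefl) iM'.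
exact: step_ideal.
Qed.

Lemma last_notin x D : (forall y, y \in D -> (rk y < rk x)%N) -> x \notin D.
Proof. by move=> hx; apply/negP=> /hx; rewrite ltnn. Qed.

Lemma setU1D x z D : x != z -> (z |: D) :\ x = z |: (D :\ x).
Proof.
by move=> n; apply/setP=> w; rewrite !inE; have [->|] := eqVneq w z; rewrite // eq_sym n.
Qed.

(** Every letter after that of [x] commutes with it, so the letter of [x] can be carried to the end
    of the word. *)
Lemma hecke_far x S : x \in S ->
  (forall z, z \in S -> (rk x < rk z)%N -> far (kappa z) (kappa x)) ->
  hecke S = obind (step (kappa x)) (hecke (S :\ x)).
Proof.
elim/last_ind: S => [|z D hz IH]; first by rewrite inE.
move=> xS hfar; have [exz|nxz] := eqVneq x z.
  by rewrite exz setU1K ?last_notin // heckeU1.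
have xD : x \in D by move: xS; rewrite !inE (negPf nxz).
rewrite setU1D // heckeU1 // heckeU1; last by move=> y; rewrite inE => /andP[_ /hz].
rewrite IH //; last by move=> y yD; apply: hfar; rewrite inE yD orbT.
case E: (hecke _) => [M|] //=; apply: stepC; first exact: hecke_ideal E.
by rewrite farC; apply: hfar; [rewrite !inE eqxx|apply: hz].
Qed.

(* Both excited moves on a cell [x], with [y] its diagonal successor. *)
Lemma hecke_move x y S : kappa y = kappa x -> (rk x < rk y)%N ->
  x \in S -> y \notin S ->
  (forall z, z \in S -> (rk x < rk z < rk y)%N -> far (kappa z) (kappa x)) ->
  hecke (y |: (S :\ x)) = hecke S /\ hecke (y |: S) = hecke S.
Proof.
move=> kxy rxy; elim/last_ind: S => [|z D hz IH]; first by rewrite inE.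
have [ryz|rzy] := ltnP (rk y) (rk z); last first.
  (* Here all of [S] precedes [y]: the letter of [x] is carried to the end, just where the letter of
     [y], of the same content, would be appended. *)
  move=> xS yS hfar; set S := z |: D in xS yS hfar *.
  have hy w : w \in S -> (rk w < rk y)%N.
    rewrite ltn_neqAle (inj_eq rk_inj) => wS; apply/andP; split.
      by apply: contraNneq yS => <-.
    by move: wS; rewrite !inE => /orP[/eqP->//|/hz/ltnW/leq_trans->].
  have hS : hecke S = obind (step (kappa x)) (hecke (S :\ x)).
    by apply: hecke_far => // w wS rw; apply: hfar; rewrite // rw hy.
  rewrite heckeU1; last by move=> w; rewrite inE => /andP[_ /hy].
  rewrite heckeU1 // kxy hS; split=> //.
  by case E: (hecke _) => [M|] //=; apply: step_idem; apply: hecke_ideal E.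
(* Now [z] comes after [y], so its letter ends all three words and can be stripped. *)
rewrite !inE !negb_or => xS /andP[nyz yD] hfar.
have nxz : x != z by apply: contraTneq ryz => <-; rewrite -leqNgt ltnW.
have xD : x \in D by move: xS; rewrite (negPf nxz).
have [w wD rw|IH1 IH2] := IH xD yD.
  by apply: hfar; rewrite ?inE ?wD ?orbT.
have zlast (A : {set cell}) : A \subset y |: D -> forall w, w \in A -> (rk w < rk z)%N.
  by move=> sA w wA; move: (subsetP sA _ wA); rewrite !inE => /orP[/eqP->//|/hz].
rewrite setU1D // ![y |: (z |: _)]setUCA.
rewrite (@heckeU1 z (y |: (D :\ x))); last by apply/zlast/setUS/subD1set.
rewrite (@heckeU1 z (y |: D)); last by apply/zlast.
by rewrite IH1 IH2 heckeU1.
Qed.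

Lemma ideal_last x D : (forall y, y \in D -> (rk y < rk x)%N) -> ideal (x |: D) ->
  ideal D /\ addable D x.
Proof.
move=> hx iD; split.
  move=> u v buv vD; have := iD _ _ buv; rewrite !inE vD orbT => /(_ isT)/orP[/eqP e|//].
  by move: (hx _ vD) (rk_below buv); rewrite e; lia.
apply/addableP; split; first exact: last_notin.
move=> y byx nyx; have := iD _ _ byx; rewrite !inE eqxx (negPf nyx) /=; exact.
Qed.

Lemma hecke_id D : ideal D -> hecke D = Some D.
Proof.
elim/last_ind: D => [_|x D hx IH iD]; first exact: hecke0.
have [iD' ax] := ideal_last hx iD.
by rewrite heckeU1 // IH //= step_add.
Qed.

(** [None] is absorbing, so every prefix of a surviving word survives. *)
Lemma hecke_prefix D m : hecke D -> hecke [set z in D | (rk z < m)%N].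
Proof.
elim/last_ind: D => [|z D hz IH].
  suff -> : [set z in set0 | (rk z < m)%N] = set0 by [].
  by apply/setP=> z; rewrite !inE.
have [lzm|lmz] := ltnP (rk z) m => h.
  have -> // : [set y in z |: D | (rk y < m)%N] = z |: D.
  apply/setP=> y; rewrite !inE; apply: andb_idr => /orP[/eqP->//|/hz].
  by move=> /ltn_trans; apply.
have -> : [set y in z |: D | (rk y < m)%N] = [set y in D | (rk y < m)%N].
  apply/setP=> y; rewrite !inE; have [->|//] := eqVneq y z.
  by rewrite ltnNge lmz /= andbF.
by apply: IH; move: h; rewrite heckeU1 //; case: (hecke D).
Qed.

(* In the reading order, the first cell of [D] lying below a missing cell can be
   moved up the diagonal. *)
Lemma hecke_reverse D M : hecke D = Some M -> D <> M ->
  exists x y u l : cell,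
    [/\ y \in D, u \notin D & l \notin D] /\
    [/\ u.1.+1 = y.1 :> nat, u.2 = y.2, l.1 = y.1, l.2.+1 = y.2 :> nat
      & x.1 = u.1 /\ x.2 = l.2].
Proof.
move=> hD nDM; pose bad y := (y \in D) && [exists x, below x y && (x \notin D)].
have [/existsP[y0 by0]|nobad] := boolP [exists y, bad y]; last first.
  case: nDM; have iD : ideal D.
    move=> x y bxy yD; apply: contraR nobad => xD; apply/existsP; exists y.
    by rewrite /bad yD; apply/existsP; exists x; rewrite bxy.
  by move: hD; rewrite hecke_id // => -[].
(* [y] is the first cell of [D] with a missing cell below it; by minimality the part [P] of [D]
   before [y] is an ideal, which its own word builds. *)
have [y /andP[yD bady] miny] := arg_minnP rk by0.
pose P := [set z in D | (rk z < rk y)%N].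
have iP : ideal P.
  move=> x z bxz; rewrite !inE => /andP[zD rz].
  have -> : (rk x < rk y)%N by apply: leq_ltn_trans rz; apply: rk_below.
  rewrite andbT; apply: contraTT rz => xD; rewrite -leqNgt; apply: miny.
  by rewrite /bad zD; apply/existsP; exists x; rewrite bxz.
have hy z : z \in P -> (rk z < rk y)%N by rewrite inE => /andP[].
have : hecke (y |: P).
  have -> : y |: P = [set z in D | (rk z < (rk y).+1)%N].
    apply/setP=> z; rewrite !inE ltnS [(rk z <= _)%N]leq_eqVlt (inj_eq rk_inj).
    by have [->|//] := eqVneq z y; rewrite yD.
  by apply: hecke_prefix; rewrite hD.
rewrite heckeU1 // hecke_id //= => hstep.
have yP : y \notin P by apply: last_notin.
(* Since the prefix ending at [y] survives, [P] has a corner [z] on the diagonal of [y]. It is not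
   [y], so it lies strictly below it. The cells just above and just left of [y] are then outside
   [P]: they dominate a missing cell if [z] is addable, and strictly dominate a removable one
   otherwise. *)
have [u [l [[e1 e2 e3 e4] [uP lP]]]] : exists u l : cell,
    [/\ u.1.+1 = y.1 :> nat, u.2 = y.2, l.1 = y.1 & l.2.+1 = y.2 :> nat]
    /\ u \notin P /\ l \notin P.
  case: (stepP (kappa y) P) hstep => // [z /addableP[zP hz]|z /removableP[zP hz]] kz _.
    have nzy : z != y.
      apply/eqP=> e; subst z; case/existsP: bady => x /andP[bxy xD].
      have nxy : x != y by apply: contraNneq xD => ->.
      by have := hz _ bxy nxy; rewrite inE (negPf xD).
    have bzy : below z y.
      by case: (kappa_below kz) => // b; move: yP; rewrite hz // eq_sym.
    have [u [l [e [b1 b2 _ _]]]] := diag_between kz bzy nzy.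
    by exists u, l; split=> //; split; apply: contra zP; apply: iP.
  have nzy : z != y by apply: contraNneq yP => <-.
  have bzy : below z y.
    by case: (kappa_below kz) => // b; move: yP; rewrite (iP _ _ b zP).
  have [u [l [e [b1 b2 n1 n2]]]] := diag_between kz bzy nzy.
  by exists u, l; split=> //; split; apply: hz; rewrite // eq_sym.
exists (u.1, l.2), y, u, l; split; last by split.
(* [u] and [l] are read before [y], so being outside [P] means being outside [D]. *)
have ru : (rk u < rk y)%N by apply/rk_ltP; left; rewrite -e1.
have rl : (rk l < rk y)%N by apply/rk_ltP; right; rewrite e3 -e4.
by split; [|apply: contra uP => h|apply: contra lP => h]; rewrite // inE h.
Qed.

(** Between [x] and [y] the reading order visits the end of the row of [x] and the beginning of the
    row of [y]. Contents there differ from that of [x] by at least two, except at [u] and [l]. *)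
Lemma diag_far x y z u l : x.1.+1 = y.1 :> nat -> x.2.+1 = y.2 :> nat ->
  u.1 = x.1 -> u.2 = y.2 -> l.1 = y.1 -> l.2 = x.2 ->
  z != u -> z != l -> (rk x < rk z < rk y)%N -> far (kappa z) (kappa x).
Proof.
move=> e1 e2 e3 e4 e5 e6 /cellP; rewrite e3 e4 => n1 /cellP; rewrite e5 e6 => n2.
case/andP=> /rk_ltP h1 /rk_ltP h2; rewrite /far /kappa.
have := ltn_ord x.1; have := ltn_ord y.1; have := ltn_ord z.1; lia.
Qed.

Lemma hecke_exc x y u l S : x.1.+1 = y.1 :> nat -> x.2.+1 = y.2 :> nat ->
  u.1 = x.1 -> u.2 = y.2 -> l.1 = y.1 -> l.2 = x.2 ->
  x \in S -> y \notin S -> u \notin S -> l \notin S ->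
  hecke (y |: (S :\ x)) = hecke S /\ hecke (y |: S) = hecke S.
Proof.
move=> e1 e2 e3 e4 e5 e6 xS yS uS lS; apply: hecke_move => //.
- by apply/kappaP; lia.
- by apply/rk_ltP; lia.
move=> z zS; apply: (diag_far e1 e2 e3 e4 e5 e6).
  by apply: contraNneq uS => <-.
by apply: contraNneq lS => <-.
Qed.

End Reading.

(** * Rook strips and their intertwining with the transposed action *)

Section Pieri.
Variables (F : fieldType) (d N : nat).
Notation cell := ('I_d * 'I_N)%type.
Implicit Types (x y z : cell) (M D S : {set cell}) (k : nat) (f : {set cell} -> F).

(** Cells addable to an ideal [M] lie in distinct rows and columns, so for ideals this says that
    [M'] is obtained from [M] by adding a rook strip. *)
Definition rook M M' : bool :=
  (M \subset M') && (M' \subset M :|: [set z | addable M z]).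

Definition rook_sum f M : F := \sum_(M' | rook M M') f M'.

(* The transpose, on functions, of the partial action [step k] on ideals. *)
Definition stepT k f M : F :=
  if [pick z | removable M z && (kappa z == k)] is Some z
  then f M + f (M :\ z) else 0.

Lemma stepT_rem f M z : ideal M -> removable M z ->
  stepT (kappa z) f M = f M + f (M :\ z).
Proof.
move=> iM rz; rewrite /stepT; case: pickP => [y /andP[ry /eqP ky]|/(_ z)].
  by rewrite (removable_uniq iM ry rz ky).
by rewrite rz eqxx.
Qed.

Lemma stepT_none k f M : (forall z, kappa z = k -> ~~ removable M z) ->
  stepT k f M = 0.
Proof.
move=> h; rewrite /stepT; case: pickP => // y /andP[ry /eqP/h].
by rewrite ry.
Qed.

Lemma sum_interval (U V : {set cell}) z f : z \notin U -> z \in V ->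
  \sum_(M : {set cell} | (U \subset M) && (M \subset V)) f M =
  \sum_(M : {set cell} | (z |: U \subset M) && (M \subset V)) (f M + f (M :\ z)).
Proof.
move=> zU zV; rewrite (bigID (fun M : {set cell} => z \in M)) big_split /=; congr (_ + _).
  by apply: eq_bigl => M; rewrite subUset sub1set andbC andbA.
rewrite (reindex_onto (fun M : {set cell} => M :\ z) (fun M => z |: M)) /=; last first.
  by move=> M /andP[_ zM]; rewrite setU1K.
apply: eq_bigl => M; rewrite subUset sub1set setD11 andbT.
have [zM|zM] := boolP (z \in M).
  rewrite setD1K // eqxx andbT /= subsetD1 zU andbT; congr (_ && _).
  by rewrite -[in RHS](setD1K zM) subUset sub1set zV.
rewrite /= [_ == M](_ : _ = false) ?andbF //.
by apply: contraNF zM => /eqP <-; rewrite !inE eqxx.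
Qed.

Lemma rook_removable M M' y : ideal M -> rook M M' -> removable M' y ->
  removable M y \/ addable M y.
Proof.
move=> iM /andP[sMM' /subsetP sM'] /removableP[yM' hy].
move: (sM' _ yM'); rewrite !inE => /orP[yM|]; last by right.
left; apply/removableP; split=> // x byx nxy; apply: contra (hy _ byx nxy).
exact: (subsetP sMM').
Qed.

Lemma rook_ideal M M' : ideal M -> rook M M' -> ideal M'.
Proof. by move=> iM /andP[]; apply: ideal_addU. Qed.

(** A strip [M'] over [M] has a removable corner of this content exactly when it contains [z]; the
    pairs [M'], [M' :\ z] produced by [stepT] then exhaust the strips over [M]. *)
Lemma rook_sum_add f M z : ideal M -> addable M z ->
  rook_sum (stepT (kappa z) f) M = rook_sum f M.
Proof.
move=> iM az; have /addableP[zM hz] := az.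
rewrite {2}/rook_sum /rook (@sum_interval _ _ z) //; last by rewrite !inE az orbT.
rewrite /rook_sum (bigID (fun M' : {set cell} => z \in M')) /= [X in _ + X]big1 ?addr0.
  apply: eq_big => [M'|M' /andP[rM zM']].
    by rewrite subUset sub1set /rook andbC andbA.
  apply: stepT_rem; first exact: rook_ideal rM.
  apply/removableP; split=> // x bzx nxz; apply/negP=> xM'.
  case/andP: rM => _ /subsetP/(_ _ xM'); rewrite !inE => /orP[xM|].
    by move: zM; rewrite (iM _ _ bzx xM).
  by case/addableP=> _ /(_ _ bzx); rewrite eq_sym nxz (negPf zM) => /(_ isT).
move=> M' /andP[rM zM']; apply: stepT_none => y ky; apply: contra zM' => ry.
have [ry'|ay] := rook_removable iM rM ry.
  by case: (addable_removableF iM az ry').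
by rewrite -(addable_uniq iM ay az ky); case/removableP: ry.
Qed.

(** Only strips over [M] that leave [z] removable contribute. Paired with the same sets deprived of
    [z], they exhaust the strips over [M :\ z], because the cells addable to [M :\ z] are [z] and
    the cells addable to [M] that do not lie above [z]. *)
Lemma rook_sum_rem f M z : ideal M -> removable M z ->
  rook_sum (stepT (kappa z) f) M = rook_sum f (M :\ z).
Proof.
move=> iM rz; have /removableP[zM hz] := rz.
have az := addable_rem iM rz.
rewrite {2}/rook_sum /rook (@sum_interval _ _ z); first last.
- by rewrite !inE az orbT.
- by rewrite !inE eqxx.
rewrite setD1K // /rook_sum (bigID (fun M' : {set cell} => removable M' z)) /=.
rewrite [X in _ + X]big1 ?addr0; last first.
  move=> M' /andP[rM nrz]; apply: stepT_none => y ky; apply: contra nrz => ry.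
  have [ry'|ay] := rook_removable iM rM ry.
    by rewrite -(removable_uniq iM ry' rz ky).
  by case: (addable_removableF iM ay rz).
apply: eq_big => [M'|M' /andP[rM rz']]; last first.
  by apply: stepT_rem; first exact: rook_ideal rM.
rewrite /rook -andbA; apply: andb_id2l => sMM'.
apply/andP/subsetP => [[/subsetP sM' /removableP[zM' hz']] y yM'|sM'].
  move: (sM' _ yM'); rewrite !inE; have [-> _|nyz /=] := eqVneq y z; first by rewrite az orbT.
  case/orP=> [->//|/addableP[yM hy]]; apply/orP; right; apply/addableP; split.
    by rewrite !inE nyz.
  move=> x bxy nxy; rewrite !inE hy // andbT; apply/eqP=> exz.
  by move: (hz' y); rewrite -exz bxy exz nyz yM' => /(_ isT isT).
split; [apply/subsetP=> y /sM'|apply/removableP; split=> [|y bzy nyz]].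
- rewrite !inE => /orP[/andP[_ ->//]|/addableP[]].
  have [->|nyz] := eqVneq y z; first by rewrite zM.
  rewrite !inE nyz /= => yM hy; apply/orP; right; apply/addableP; split=> // x bxy nxy.
  by have := hy _ bxy nxy; rewrite !inE => /andP[].
- exact: (subsetP sMM').
- apply/negP=> /sM'; rewrite !inE (negPf (hz _ bzy nyz)) andbF /= => /addableP[_ h].
  by have := h _ bzy; rewrite eq_sym nyz !inE eqxx => /(_ isT).
Qed.

Lemma rook_sum_none f M k : ideal M -> (forall z, kappa z = k -> ~~ addable M z) ->
  (forall z, kappa z = k -> ~~ removable M z) -> rook_sum (stepT k f) M = 0.
Proof.
move=> iM ha hr; apply: big1 => M' rM; apply: stepT_none => z kz; apply/negP=> rz.
case: (rook_removable iM rM rz) => h; first by move: (hr _ kz); rewrite h.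
by move: (ha _ kz); rewrite h.
Qed.

(** The preimages of [M] under [step k] among ideals are [M] itself and [M] without its removable
    corner of content [k]; there are none if no such corner exists. *)
Lemma stepT_step k D M : ideal M ->
  (obind (step k) (hecke D) == Some M)%:R =
  stepT k (fun M' => (hecke D == Some M')%:R) M :> F.
Proof.
move=> iM; case E: (hecke D) => [M0|] /=; last first.
  by rewrite /stepT; case: pickP => //= *; rewrite addr0.
have iM0 := hecke_ideal E; rewrite /stepT.
have eqS (A B : {set cell}) : (Some A == Some B) = (A == B) by [].
case: pickP => [z /andP[rz /eqP <-]|h].
  have zM : z \in M by case/removableP: rz.
  rewrite !eqS; have [->|nM] := eqVneq M0 M.
    rewrite step_rem // eqxx [M == _](_ : _ = false) ?addr0 //.
    by apply: contraTF zM => /eqP->; rewrite !inE eqxx.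
  have [->|nM'] := eqVneq M0 (M :\ z).
    rewrite step_add ?addable_rem //; last exact: ideal_rem.
    by rewrite setD1K // eqxx add0r.
  rewrite addr0; case: (stepP (kappa z) M0) => [y ay ky|y ry ky|//]; rewrite eqS.
    case: eqP => // e; case/eqP: nM'; rewrite -e in rz iM *.
    by rewrite -(removable_uniq iM (removable_add iM0 ay) rz ky) setU1K //; case/addableP: ay.
  by rewrite (negPf nM).
case: (stepP k M0) => [y ay ky|y ry ky|//]; rewrite eqS; case: eqP => // e.
  by have := h y; rewrite -e removable_add // ky eqxx.
by have := h y; rewrite -e ry ky eqxx.
Qed.

(** The product of the operators 1 + p T over the cells of [pi], expanded over subsets: the
    coefficient of [M] when it is applied to the empty diagram. *)
Definition hecke_sum (p : cell -> F) (pi : {set cell}) M : F :=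
  \sum_(D : {set cell} | D \subset pi) (hecke D == Some M)%:R * \prod_(y in D) p y.

Lemma hecke_sum0 p M : hecke_sum p set0 M = (M == set0)%:R.
Proof.
rewrite /hecke_sum (big_pred1 set0) => [|D]; last by rewrite subset0.
by rewrite hecke0 big_set0 mulr1 (eq_sym M).
Qed.

Lemma hecke_sum_last p x (pi : {set cell}) M :
  (forall y, y \in pi -> (rk y < rk x)%N) -> ideal M ->
  hecke_sum p (x |: pi) M =
  hecke_sum p pi M + p x * stepT (kappa x) (hecke_sum p pi) M.
Proof.
move=> hx iM; have xpi := last_notin hx.
rewrite {1}/hecke_sum (bigID (fun D : {set cell} => x \in D)) /= addrC; congr (_ + _).
  apply: eq_bigl => D; apply/andP/idP => [[sD xD]|sD].
    apply/subsetP=> y yD; move/subsetP: sD => /(_ _ yD); rewrite !inE.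
    by case/orP=> [/eqP e|//]; rewrite -e yD in xD.
  split; first by rewrite (subset_trans sD) // subsetUr.
  by apply: contra xpi; apply: (subsetP sD).
rewrite (reindex_onto (fun D : {set cell} => x |: D) (fun D => D :\ x)) /=; last first.
  by move=> D /andP[_ xD]; rewrite setD1K.
transitivity (\sum_(D : {set cell} | D \subset pi) p x *
   (stepT (kappa x) (fun M' => (hecke D == Some M')%:R) M * \prod_(y in D) p y)).
  apply: eq_big => [D|D /andP[/andP[sD _] /eqP eD]].
    rewrite !inE eqxx /= andbT; have [xD|xD] := boolP (x \in D).
      have -> : (D \subset pi) = false.
        by apply/negP=> sD; rewrite (subsetP sD _ xD) in xpi.
      by apply/negP=> /andP[_ /eqP e]; move: xD; rewrite -e !inE eqxx.
    rewrite setU1K // eqxx andbT subUset sub1set !inE eqxx /=.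
    apply/subsetP/subsetP => h y yD; last by rewrite inE h // orbT.
    by move: (h _ yD); rewrite !inE => /orP[/eqP e|//]; rewrite e (negPf xD) in yD.
  have xD : x \notin D by rewrite -eD !inE eqxx.
  have sD' y : y \in D -> y \in pi.
    move=> yD; move/subsetP: sD => /(_ y); rewrite !inE yD orbT => /(_ isT).
    by case/orP=> [/eqP e|//]; rewrite e (negPf xD) in yD.
  rewrite heckeU1; last by move=> y /sD'/hx.
  by rewrite stepT_step // big_setU1 //= mulrCA.
rewrite -mulr_sumr; congr (_ * _); rewrite {2}/stepT.
case E: [pick z | _] => [z|]; rewrite /stepT.
  by rewrite -big_split /=; apply: eq_bigr => D _; rewrite E mulrDl.
by apply: big1 => D _; rewrite E mul0r.
Qed.

End Pieri.

(** * Boundary paths: positions of row and column steps *)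

Section Positions.
Variables (d N : nat).
Notation cell := ('I_d * 'I_N)%type.
Implicit Types (x y z : cell) (M D S : {set cell}) (i : 'I_d) (j : 'I_N).

Definition rowlen M i : nat := #|[set j | (i, j) \in M]|.
Definition collen M j : nat := #|[set i | (i, j) \in M]|.

(* Positions, from 0 to [d + N - 1], of the vertical step of row [i] and of the
   horizontal step of column [j] on the boundary path of [M]. *)
Definition rowpos M i : nat := (rowlen M i + (d - i.+1))%N.
Definition colpos M j : nat := (d + j - collen M j)%N.

Lemma card_ord_lt n m : (m <= n)%N -> #|[set j : 'I_n | (j < m)%N]| = m.
Proof.
move=> le_mn; have winj : injective (widen_ord le_mn) by move=> a b [/val_inj].
rewrite -[RHS]card_ord -(card_imset predT winj).
apply: eq_card => j; rewrite inE; apply/idP/imsetP => [jm|[k _ ->]]; last exact: (ltn_ord k).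
by exists (Ordinal jm) => //; apply: val_inj.
Qed.

Lemma mem_downset n (J : {set 'I_n}) (j : 'I_n) :
  (forall a b : 'I_n, (a <= b)%N -> b \in J -> a \in J) -> (j \in J) = (j < #|J|)%N.
Proof.
move=> dJ; apply/idP/idP => [jJ|]; last first.
  apply: contraTT => jJ; rewrite -leqNgt -(card_ord_lt (ltnW (ltn_ord j))).
  apply/subset_leq_card/subsetP => b bJ; rewrite inE ltnNge.
  by apply: contra jJ => /dJ; apply.
rewrite -[X in (X <= _)%N](card_ord_lt (ltn_ord j)).
by apply/subset_leq_card/subsetP => b; rewrite inE ltnS => /dJ; apply.
Qed.

Lemma mem_rowlen M x : ideal M -> (x \in M) = (x.2 < rowlen M x.1)%N.
Proof.
case: x => i j iM /=; rewrite /rowlen -mem_downset ?inE // => a b ab.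
by rewrite !inE; apply: iM; rewrite /below /= leqnn.
Qed.

Lemma mem_collen M x : ideal M -> (x \in M) = (x.1 < collen M x.2)%N.
Proof.
case: x => i j iM /=; rewrite /collen -mem_downset ?inE // => a b ab.
by rewrite !inE; apply: iM; rewrite /below /= leqnn andbT.
Qed.

Lemma rowlen_le M i : (rowlen M i <= N)%N.
Proof. by rewrite /rowlen (leq_trans (max_card _)) ?card_ord. Qed.

Lemma collen_le M j : (collen M j <= d)%N.
Proof. by rewrite /collen (leq_trans (max_card _)) ?card_ord. Qed.

Lemma rowlen_anti M i i' : ideal M -> (i <= i')%N -> (rowlen M i' <= rowlen M i)%N.
Proof.
move=> iM le_ii'; apply/subset_leq_card/subsetP => j; rewrite !inE.
by apply: iM; rewrite /below /= leqnn andbT.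
Qed.

Lemma collen_anti M j j' : ideal M -> (j <= j')%N -> (collen M j' <= collen M j)%N.
Proof.
move=> iM le_jj'; apply/subset_leq_card/subsetP => i; rewrite !inE.
by apply: iM; rewrite /below /= leqnn.
Qed.

Lemma rowpos_lt M i i' : ideal M -> (i < i')%N -> (rowpos M i' < rowpos M i)%N.
Proof.
move=> iM lt_ii'; have := rowlen_anti iM (ltnW lt_ii'); have := ltn_ord i'.
by rewrite /rowpos; lia.
Qed.

Lemma colpos_lt M j j' : ideal M -> (j < j')%N -> (colpos M j < colpos M j')%N.
Proof.
move=> iM lt_jj'; have := collen_anti iM (ltnW lt_jj').
by have := collen_le M j; have := collen_le M j'; rewrite /colpos; lia.
Qed.

Lemma rowpos_inj M : ideal M -> injective (rowpos M).
Proof.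
move=> iM i i' e; apply/eqP; rewrite eqE /=; apply/eqP.
by case: (ltngtP i i') => // /(rowpos_lt iM); rewrite e ltnn.
Qed.

Lemma colpos_inj M : ideal M -> injective (colpos M).
Proof.
move=> iM j j' e; apply/eqP; rewrite eqE /=; apply/eqP.
by case: (ltngtP j j') => // /(colpos_lt iM); rewrite e ltnn.
Qed.

Lemma rowlen_add M z i : z \notin M ->
  rowlen (z |: M) i = ((i == z.1) + rowlen M i)%N.
Proof.
case: z => a b /= zM; rewrite /rowlen; have [->|ni] /= := eqVneq i a.
  rewrite [in LHS](_ : [set j | _] = b |: [set j | (a, j) \in M]); last first.
    by apply/setP=> j; rewrite !inE xpair_eqE eqxx.
  by rewrite cardsU1 inE zM.
by rewrite add0n; apply: eq_card => j; rewrite !inE xpair_eqE (negPf ni).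
Qed.

Lemma collen_add M z j : z \notin M ->
  collen (z |: M) j = ((j == z.2) + collen M j)%N.
Proof.
case: z => a b /= zM; rewrite /collen; have [->|ni] /= := eqVneq j b.
  rewrite [in LHS](_ : [set i | _] = a |: [set i | (i, b) \in M]); last first.
    by apply/setP=> i; rewrite !inE xpair_eqE eqxx andbT.
  by rewrite cardsU1 inE zM.
by rewrite add0n; apply: eq_card => i; rewrite !inE xpair_eqE (negPf ni) andbF.
Qed.

Lemma rowlen_addable M z : ideal M -> addable M z -> rowlen M z.1 = z.2.
Proof.
move=> iM az; have := az => /addableP[zM _]; have iM' := ideal_add iM az.
have := mem_rowlen z iM; rewrite (negPf zM) => /esym/negbT; rewrite -leqNgt.
have := mem_rowlen z iM'; rewrite !inE eqxx rowlen_add // eqxx.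
by move: (rowlen M z.1) => r; lia.
Qed.

Lemma collen_addable M z : ideal M -> addable M z -> collen M z.2 = z.1.
Proof.
move=> iM az; have := az => /addableP[zM _]; have iM' := ideal_add iM az.
have := mem_collen z iM; rewrite (negPf zM) => /esym/negbT; rewrite -leqNgt.
have := mem_collen z iM'; rewrite !inE eqxx collen_add // eqxx.
by move: (collen M z.2) => r; lia.
Qed.

Lemma rowpos_addable M z : ideal M -> addable M z -> rowpos M z.1 = kappa z.
Proof. by move=> iM az; rewrite /rowpos rowlen_addable. Qed.

Lemma rowpos_add M z i : z \notin M ->
  rowpos (z |: M) i = ((i == z.1) + rowpos M i)%N.
Proof. by move=> zM; rewrite /rowpos rowlen_add // addnA. Qed.

Lemma colpos_addable M z : ideal M -> addable M z -> colpos M z.2 = (kappa z).+1.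
Proof.
move=> iM az; rewrite /colpos /kappa collen_addable //.
by have := ltn_ord z.1; lia.
Qed.

Lemma colpos_add M z j : ideal M -> addable M z ->
  colpos (z |: M) j = if j == z.2 then kappa z else colpos M j.
Proof.
move=> iM az; have /addableP[zM _] := az; rewrite /colpos collen_add //.
case: eqP => [->|//]; rewrite collen_addable // /kappa.
by have := ltn_ord z.1; lia.
Qed.

(** The adjacent transposition by which adding a cell of content [k] acts on the positions of the
    boundary path. *)
Definition swap (k m : nat) : nat :=
  if m == k then k.+1 else if m == k.+1 then k else m.

Lemma swap_id k m : m != k -> m != k.+1 -> swap k m = m.
Proof. by rewrite /swap => /negPf-> /negPf->. Qed.

Lemma swapl k : swap k k = k.+1. Proof. by rewrite /swap eqxx. Qed.
Lemma swapr k : swap k k.+1 = k. Proof. by rewrite /swap gtn_eqF ?eqxx. Qed.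

(** Row positions are distinct both before and after [z] is added. Row [z.1] occupies [kappa z]
    before and the next position after, while row [i] does not move. *)
Lemma rowpos_other M z i : ideal M -> addable M z -> i != z.1 ->
  (rowpos M i != kappa z) && (rowpos M i != (kappa z).+1).
Proof.
move=> iM az ni; have /addableP[zM _] := az.
have pz := rowpos_addable iM az; rewrite -pz (inj_eq (rowpos_inj iM)) ni /=.
have := inj_eq (rowpos_inj (ideal_add iM az)) i z.1.
by rewrite !rowpos_add // eqxx (negPf ni) /= add0n add1n => ->.
Qed.

Lemma colpos_other M z j : ideal M -> addable M z -> j != z.2 ->
  (colpos M j != kappa z) && (colpos M j != (kappa z).+1).
Proof.
move=> iM az nj; have pz := colpos_addable iM az.
rewrite -pz (inj_eq (colpos_inj iM)) nj andbT.
have := inj_eq (colpos_inj (ideal_add iM az)) j z.2.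
by rewrite !colpos_add // eqxx (negPf nj) => ->.
Qed.

(** Steps of different kinds at positions [kappa x] and [(kappa x).+1] of the boundary path would
    form a corner of that content, addable or removable. *)
Lemma rowpos_both M (x : cell) : ideal M ->
  (forall z, kappa z = kappa x -> ~~ addable M z) ->
  (forall z, kappa z = kappa x -> ~~ removable M z) ->
  (exists i, rowpos M i = kappa x) <-> (exists i, rowpos M i = (kappa x).+1).
Proof.
move=> iM ha hr; split=> -[i pi].
  have [hN|hlt] := leqP N (rowlen M i).
    have eN : rowlen M i = N by apply/eqP; rewrite eqn_leq hN rowlen_le.
    (* Row [i] fills the box, so no cell can be added to it. As [x] is a cell of the box, [kappa x]
       is at most d + N - 2, so [i] is not the first row; the row above is also full and sits one
       position higher. *)
    have i0 : (0 < i)%N.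
      move: pi; rewrite /rowpos eN /kappa; have := ltn_ord x.1; have := ltn_ord x.2; lia.
    have lt_i : (i.-1 < d)%N by have := ltn_ord i; lia.
    exists (Ordinal lt_i); rewrite -pi /rowpos /=.
    have := @rowlen_anti M (Ordinal lt_i) i iM (leq_pred _).
    have := rowlen_le M (Ordinal lt_i); have := ltn_ord i; lia.
  have := ha (i, Ordinal hlt); rewrite {1}/kappa /= -/(rowpos M i) => /(_ pi) nadd.
  (* Only a row of equal length just above can prevent adding the cell at the end of row [i]. *)
  have [i0 e] : (0 < i)%N /\ forall i' : 'I_d, i'.+1 = i :> nat -> rowlen M i' = rowlen M i.
    have [i0|i0] := posnP i.
      case/addableP: nadd; split; first by rewrite mem_rowlen // ltnn.
      move=> [a b]; rewrite mem_rowlen // /below /= xpair_eqE => /andP[hai hb] n.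
      have ea : a = i by apply: val_inj => /=; lia.
      by rewrite ea in n *; move: n; rewrite eqxx /= eqE /=; lia.
    split=> // i' ei'; have le_r := @rowlen_anti M i' i iM; apply/eqP.
    rewrite eqn_leq le_r ?andbT; last by lia.
    rewrite leqNgt; apply: contra nadd => lt_r; apply/addableP.
    split; first by rewrite mem_rowlen // ltnn.
    move=> [a b]; rewrite mem_rowlen // /below /= xpair_eqE => /andP[hai hb] n.
    have [ea|na] := eqVneq a i.
      by rewrite ea in n *; move: n; rewrite eqxx /= eqE /=; lia.
    have le_a : (a <= i')%N by move: na; rewrite eqE /=; lia.
    by have := rowlen_anti iM le_a; lia.
  have lt_i : (i.-1 < d)%N by have := ltn_ord i; lia.
  exists (Ordinal lt_i); rewrite -pi /rowpos e /=; last by lia.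
  by have := ltn_ord i; lia.
have e : (i.+1 < d)%N /\ forall i' : 'I_d, (i' = i.+1 :> nat) -> rowlen M i' = rowlen M i.
  (* An empty row at a positive position is not the last one, and the next row is empty too. *)
  have [r0|rpos] := posnP (rowlen M i).
    split; first by move: pi; rewrite /rowpos r0; lia.
    move=> i' ei'; have : (i <= i')%N by lia.
    by move/(rowlen_anti iM); lia.
  have hlt : ((rowlen M i).-1 < N)%N by have := rowlen_le M i; lia.
  have kz : kappa ((i, Ordinal hlt) : cell) = kappa x.
    by rewrite {1}/kappa /=; move: pi; rewrite /rowpos; lia.
  have nrem := hr _ kz.
  have rem (h : forall i' : 'I_d, (i < i')%N -> (rowlen M i' < rowlen M i)%N) : False.
    case/removableP: nrem; split; first by rewrite mem_rowlen //=; lia.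
    move=> [a b]; rewrite mem_rowlen // /below /= xpair_eqE => /andP[hai hb] n.
    have [ea|na] := eqVneq a i.
      by rewrite ea in n *; move: n; rewrite eqxx /= eqE /=; lia.
    have lt_a : (i < a)%N by move: na; rewrite eqE /=; lia.
    by have := h _ lt_a; lia.
  have [hd|hd] := ltnP i.+1 d; last first.
    by case: rem => i' ?; have := ltn_ord i'; lia.
  split=> // i' ei'; have le_r : (rowlen M i' <= rowlen M i)%N.
    by apply: (rowlen_anti iM); lia.
  apply/eqP; rewrite eqn_leq le_r leqNgt; apply/negP=> lt_r; apply: rem => a la.
  by have : (i' <= a)%N by [lia]; move/(rowlen_anti iM); lia.
case: e => lt_i e; exists (Ordinal lt_i); move: pi; rewrite /rowpos (e (Ordinal lt_i)) //=.
by lia.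
Qed.

End Positions.

(** * Weights of ideals and the Chevalley rule *)

Section Chevalley.
Variables (F : fieldType) (d N : nat).
Notation cell := ('I_d * 'I_N)%type.
Implicit Types (x y z : cell) (M D S : {set cell}) (k : nat) (c : nat -> F).

Definition weight c M : F := \prod_(i < d) c (rowpos M i).

Lemma weight_add c M z : ideal M -> addable M z ->
  exists rho, [/\ weight c M = c (kappa z) * rho,
                  weight c (z |: M) = c (kappa z).+1 * rho,
                  weight (c \o swap (kappa z)) M = c (kappa z).+1 * rho
                & weight (c \o swap (kappa z)) (z |: M) = c (kappa z) * rho].
Proof.
move=> iM az; have /addableP[zM _] := az; have pz := rowpos_addable iM az.
exists (\prod_(i < d | i != z.1) c (rowpos M i)).
have other i : i != z.1 -> swap (kappa z) (rowpos M i) = rowpos M i.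
  by move=> ni; have /andP[] := rowpos_other iM az ni; apply: swap_id.
have addo i : i != z.1 -> rowpos (z |: M) i = rowpos M i.
  by move=> ni; rewrite rowpos_add // (negPf ni).
have addz : rowpos (z |: M) z.1 = (kappa z).+1 by rewrite rowpos_add // eqxx pz.
split; rewrite /weight (bigD1 z.1) //= ?addz ?pz ?swapl ?swapr; congr (_ * _);
  by apply: eq_bigr => i ni; rewrite ?addo ?other.
Qed.

(** By [rowpos_both], either both exchanged positions belong to rows, whose factors trade places, or
    neither does and no factor changes. *)
Lemma weight_swap c M x : ideal M ->
  (forall z, kappa z = kappa x -> ~~ addable M z) ->
  (forall z, kappa z = kappa x -> ~~ removable M z) ->
  weight (c \o swap (kappa x)) M = weight c M.
Proof.
move=> iM ha hr; have both := rowpos_both iM ha hr.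
have [/existsP[i /eqP pi]|no] := boolP [exists i, rowpos M i == kappa x].
  have [|i' pi'] := both.1; first by exists i.
  rewrite /weight (reindex_inj (@perm_inj _ (tperm i i'))) /=.
  apply: eq_bigr => a _; case: tpermP => [->|->|ni ni'].
  - by rewrite pi' swapr pi.
  - by rewrite pi swapl pi'.
  rewrite swap_id //; first by rewrite -pi (inj_eq (rowpos_inj iM)); apply/eqP.
  by rewrite -pi' (inj_eq (rowpos_inj iM)); apply/eqP.
apply: eq_bigr => a _ /=; rewrite swap_id //; apply/eqP=> pa; move/negP: no; apply.
  by apply/existsP; exists a; rewrite pa.
have [|i pi] := both.2; first by exists a.
by apply/existsP; exists i; rewrite pi.
Qed.

(* The swap of two adjacent values of [c] records how the labels of the boundary
   path change when the last cell of [pi] is removed, which makes the induction on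
   [pi] go through with fixed row labels [r] and column labels [q]. *)
Theorem chevalley (r : 'I_d -> F) (q : 'I_N -> F) (pi : {set cell}) c M :
  (forall i, r i != 0) -> ideal pi ->
  (forall i, c (rowpos pi i) = r i) -> (forall j, c (colpos pi j) = q j) -> ideal M ->
  let Z := hecke_sum (fun x => q x.2 / r x.1 - 1) pi in
  weight c M * Z M = (\prod_i r i) * rook_sum Z M.
Proof.
move=> r0; elim/last_ind: pi c M => [|x pi hx IH] c M iP cr cq iM /=.
  have zero M' : hecke_sum (fun x => q x.2 / r x.1 - 1) set0 M' = (M' == set0)%:R.
    exact: hecke_sum0.
  rewrite zero; have [->|nM] := eqVneq M set0.
    rewrite mulr1 /rook_sum (bigD1 set0) /=; last by rewrite /rook !sub0set.
    rewrite zero eqxx [X in _ + X]big1 ?addr0 ?mulr1; last first.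
      by move=> M' /andP[_ /negPf nM']; rewrite zero nM'.
    by apply: eq_bigr => i _; rewrite cr.
  rewrite mulr0 /rook_sum [X in _ * X]big1 ?mulr0 // => M' /andP[sM _]; rewrite zero.
  by case: eqP => // e; move: nM sM; rewrite e subset0 => /negPf->.
have [iP' ax] := ideal_last hx iP; have /addableP[xpi _] := ax.
set k := kappa x; set c' := c \o swap k.
have cr' i : c' (rowpos pi i) = r i.
  rewrite /c' /= -cr rowpos_add //; have [->|ni] := eqVneq i x.1.
    by rewrite rowpos_addable // swapl.
  by have /andP[] := rowpos_other iP' ax ni => *; rewrite swap_id.
have cq' j : c' (colpos pi j) = q j.
  rewrite /c' /= -cq colpos_add //; have [->|nj] := eqVneq j x.2.
    by rewrite colpos_addable // swapr.
  by have /andP[] := colpos_other iP' ax nj => *; rewrite swap_id.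
have {}IH M' iM' := IH c' M' iP' cr' cq' iM'.
have ck1 : c k.+1 = r x.1 by rewrite -cr rowpos_add // eqxx rowpos_addable.
have ck : c k = q x.2 by rewrite -cq colpos_add // eqxx.
set p := fun x : cell => q x.2 / r x.1 - 1 in IH *.
have lastE M' : ideal M' -> hecke_sum p (x |: pi) M' =
    hecke_sum p pi M' + p x * stepT k (hecke_sum p pi) M' by apply: hecke_sum_last.
have -> : rook_sum (hecke_sum p (x |: pi)) M =
    rook_sum (hecke_sum p pi) M + p x * rook_sum (stepT k (hecke_sum p pi)) M.
  rewrite /rook_sum mulr_sumr -big_split; apply: eq_bigr => M' rM.
  by apply: lastE; apply: rook_ideal rM.
rewrite lastE // !mulrDr -IH // [_ * (p x * rook_sum _ _)]mulrCA.
have [/existsP[z /andP[az /eqP kz]]|noadd] := boolP [exists z, addable M z && (kappa z == k)].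
  (* Addable corner: the coefficient of [M] is unchanged while the rook sum is multiplied by
     [1 + p x], which is [c k / c k.+1], the ratio of the weights of [M] for [c] and for [c']. *)
  rewrite -kz rook_sum_add // stepT_none; last first.
    by move=> y ky; apply/negP=> ry; apply: (addable_removableF iM az ry ky).
  have [rho [w1 _ w3 _]] := weight_add c iM az.
  rewrite kz in w1 w3; rewrite -IH // /c' w1 w3 ck ck1 /p; field.
  exact: r0.
have [/existsP[z /andP[rz /eqP kz]]|norem] := boolP [exists z, removable M z && (kappa z == k)].
  (* Removable corner: both sides are combinations of the coefficients of [M] and of [M :\ z], and
     agree in each separately. *)
  have iMz := ideal_rem iM rz; have az := addable_rem iM rz.
  rewrite -kz rook_sum_rem // -IH // stepT_rem //.
  have [rho [w1 w2 w3 w4]] := weight_add c iMz az.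
  have zM : z \in M by case/removableP: rz.
  rewrite setD1K // kz in w2 w4; rewrite kz in w3.
  rewrite /c' w2 w3 w4 ck ck1 /p; field.
  exact: r0.
have ha z : kappa z = k -> ~~ addable M z.
  by move=> kz; apply: contra noadd => az; apply/existsP; exists z; rewrite az kz eqxx.
have hr z : kappa z = k -> ~~ removable M z.
  by move=> kz; apply: contra norem => rz; apply/existsP; exists z; rewrite rz kz eqxx.
by rewrite rook_sum_none // stepT_none // !mulr0 !addr0 weight_swap.
Qed.

End Chevalley.

(** * Generalized excited diagrams as the fibres of [hecke] *)

Section Excited.
Variables (d : nat) (la : seq nat).
Hypothesis la_part : is_partition la.
Notation cell := ('I_d * 'I_(part la 1))%type.
Notation lam := (diag_set d la la).
Implicit Types (x y z u l : cell) (M D S : {set cell}).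

Lemma part_anti p i j : is_partition p -> (i <= j)%N -> (part p j.+1 <= part p i.+1)%N.
Proof.
move=> /andP[sp _] le_ij; rewrite /part /=.
have [hj|hj] := leqP (size p) j; first by rewrite nth_default.
have tr : transitive geq by move=> a b c /= h1 h2; apply: leq_trans h2 h1.
apply: (sorted_leq_nth tr (fun a => leqnn a) 0%N sp) => //.
by rewrite inE (leq_ltn_trans le_ij).
Qed.

Lemma mem_diag p x : (x \in diag_set d la p) = (x.2 < part p x.1.+1)%N.
Proof. by rewrite inE. Qed.

Lemma ideal_diag p : is_partition p -> ideal (diag_set d la p).
Proof.
move=> pp x y /andP[h1 h2]; rewrite !mem_diag => h.
exact: leq_ltn_trans h2 (leq_trans h (part_anti pp h1)).
Qed.

Lemma inS_cellpos S x : inS S (cellpos x) = (x \in S).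
Proof.
apply/existsP/idP => [[y /andP[yS /eqP[e1 e2]]]|xS]; last by exists x; rewrite xS /=.
by have <- : y = x by apply/eqP/cellP.
Qed.

Definition exc_square x y u l : Prop :=
  [/\ x.1.+1 = y.1 :> nat, x.2.+1 = y.2 :> nat & u.1 = x.1 /\ u.2 = y.2] /\
  l.1 = y.1 /\ l.2 = x.2.

Lemma exc_moveP S S' :
  reflect (exists x y u l, [/\ exc_square x y u l, x \in S,
    [/\ y \notin S, u \notin S & l \notin S], y \in lam &
    S' = y |: (S :\ x) \/ S' = y |: S]) (exc_move S S').
Proof.
apply: (iffP existsP) => [[x /andP[ax /existsP[y /andP[/eqP[e1 e2] hS']]]]|].
  have ey : ((x.1 : nat).+2, (x.2 : nat).+2) = cellpos y by rewrite /cellpos e1 e2.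
  pose u : cell := (x.1, y.2); pose l : cell := (y.1, x.2).
  have eu : ((x.1 : nat).+1, (x.2 : nat).+2) = cellpos u by rewrite /cellpos /= e2.
  have el : ((x.1 : nat).+2, (x.2 : nat).+1) = cellpos l by rewrite /cellpos /= e1.
  move: ax; rewrite /active /= ey eu el !inS_cellpos.
  case/and4P=> xS /andP[_ lS] /andP[_ uS] /andP[yl yS].
  exists x, y, u, l; split=> //; first by rewrite inE.
  by move: hS'; rewrite [S :\ x :|: _]setUC [S :|: _]setUC => /orP[]/eqP; auto.
case=> x [y [u [l [[[e1 e2 [e3 e4]] [e5 e6]] xS [yS uS lS] yl hS']]]].
exists x; apply/andP; split; last first.
  apply/existsP; exists y; rewrite /cellpos /= e1 e2 eqxx /=.
  by rewrite [S :\ x :|: _]setUC [S :|: _]setUC; case: hS' => ->; rewrite eqxx ?orbT.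
have ey : ((x.1 : nat).+2, (x.2 : nat).+2) = cellpos y by rewrite /cellpos -e1 -e2.
have eu : ((x.1 : nat).+1, (x.2 : nat).+2) = cellpos u by rewrite /cellpos e3 e4 -e2.
have el : ((x.1 : nat).+2, (x.2 : nat).+1) = cellpos l by rewrite /cellpos e5 e6 -e1.
have [ul ll] : u \in lam /\ l \in lam.
  by split; apply: (ideal_diag la_part) yl; rewrite /below ?e3 ?e4 ?e5 ?e6; lia.
rewrite /active /= ey eu el !inS_cellpos xS yS uS lS !andbT.
by move: ul ll yl; rewrite !inE => -> -> ->.
Qed.

Lemma exc_move_hecke S S' : exc_move S S' -> S \subset lam ->
  S' \subset lam /\ hecke S' = hecke S.
Proof.
case/exc_moveP=> x [y [u [l [[[e1 e2 [e3 e4]] [e5 e6]] xS [yS uS lS] yl hS']]]] sS.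
have [h1 h2] := hecke_exc e1 e2 e3 e4 e5 e6 xS yS uS lS.
case: hS' => ->; split=> //; rewrite subUset sub1set yl //=.
by apply: subset_trans sS; apply: subD1set.
Qed.

(** Moves are undone one at a time. An undone move slides a cell up its diagonal or deletes it, so
    [wt] decreases until [D] is [M]. *)
Lemma hecke_connect M D : D \subset lam -> hecke D = Some M ->
  connect (@exc_move d la) M D /\ M \subset lam.
Proof.
pose wt (A : {set cell}) := (\sum_(x in A) (x.1 + x.2).+1)%N.
have [n] := ubnP (wt D); elim: n => // n IH in D * => hn sD hD.
have [eDM|/eqP nDM] := eqVneq D M; first by rewrite -eDM.
have [x [y [u [l [[yD uD lD] [e1 e2 e3 e4 [e5 e6]]]]]]] := hecke_reverse hD nDM.
have f1 : x.1.+1 = y.1 :> nat by rewrite e5.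
have f2 : x.2.+1 = y.2 :> nat by rewrite e6.
have sq : exc_square x y u l by split; split.
have nxy : x != y by apply/cellP; lia.
have xl : x \in lam.
  by apply: (ideal_diag la_part) (subsetP sD _ yD); rewrite /below; lia.
have nux : u != x by apply/cellP=> -[_]; rewrite e2 -f2; lia.
have nlx : l != x by apply/cellP=> -[]; rewrite e3 -f1; lia.
have ltxy : ((x.1 + x.2).+1 < (y.1 + y.2).+1)%N by rewrite -f1 -f2; lia.
(* One formula for both types: it undoes type II if [x] is already in [D], and type I otherwise. *)
pose S := x |: (D :\ y).
have sS : S \subset lam.
  by rewrite subUset sub1set xl (subset_trans _ sD) // subD1set.
have [xS yS] : x \in S /\ y \notin S by rewrite !inE !eqxx [y == x]eq_sym (negPf nxy).
have [uS lS] : u \notin S /\ l \notin S.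
  by rewrite !inE !negb_or (negPf uD) (negPf lD) nux nlx !andbF.
have move_D : D = y |: (S :\ x) \/ D = y |: S.
  have [xD|xD] := boolP (x \in D).
    by right; rewrite /S setUCA setD1K // (setUidPr _) // sub1set.
  by left; rewrite /S setU1K ?setD1K // !inE negb_and xD orbT.
have mSD : exc_move S D.
  by apply/(@exc_moveP S D); exists x, y, u, l; split=> //; apply: (subsetP sD).
have [_ hSD] := exc_move_hecke mSD sS.
have [|c sM] := IH S _ sS (etrans (esym hSD) hD); last first.
  by split=> //; apply: connect_trans c (connect1 mSD).
rewrite ltnS in hn; apply: leq_trans hn; rewrite /wt (big_setD1 y yD) /=.
have [xDy|xDy] := boolP (x \in D :\ y).
  by rewrite /S (setUidPr _) ?sub1set // -[X in (X < _)%N]add0n ltn_add2r.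
by rewrite /S (big_setU1 _ xDy) /= ltn_add2r ltxy.
Qed.

Lemma connect_exc M D : ideal M -> M \subset lam ->
  connect (@exc_move d la) M D = (D \subset lam) && (hecke D == Some M).
Proof.
move=> iM sM; apply/idP/andP => [/connectP[s ps ->]|[sD /eqP hD]]; last first.
  by case: (hecke_connect sD hD).
have hM := hecke_id iM; rewrite -hM.
elim: s M {iM hM} sM ps => [|S s IH] M sM /=; first by rewrite eqxx.
by case/andP=> mS ps; have [sS <-] := exc_move_hecke mS sM; apply: IH.
Qed.

End Excited.

(** * Increasing tableaux and the removal of the entries 1 *)

Section IncreasingTableaux.
Variables (d : nat) (la : seq nat).
Hypothesis la_part : is_partition la.
Notation cell := ('I_d * 'I_(part la 1))%type.
Notation lam := (diag_set d la la).
Implicit Types (x y z : cell) (M : {set cell}) (T : Tab d la).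

(** The inner shape is a set of cells instead of a partition, so that absorbing the cells of entry 1
    into it stays within the same notion. *)
Definition sit M T : bool :=
  [&& [forall x, (0 < T x)%N == (x \in lam) && (x \notin M)],
      [forall x, forall y,
         [&& below x y, x != y, x \notin M & y \in lam] ==> (T x < T y)%N] &
      [forall k : 'I_(Bnd d la),
         (1 <= k <= mT T)%N ==> [exists x, (T x : nat) == k]]].

(** Cells of the inner shape carry the dummy value 0, so for positive [k] they are included and this
    is the diagram of the partition called nu(T_{<k}). *)
Definition sublevel T k : {set cell} := [set x in lam | (T x < k)%N].

Lemma mem_sublevel T k x : (x \in sublevel T k) = (x \in lam) && (T x < k)%N.
Proof. by rewrite inE. Qed.

Lemma mT_leP T m : reflect (forall x, (T x <= m)%N) (mT T <= m)%N.
Proof. by apply: (iffP (bigmax_leqP _ _ _)) => h x; auto. Qed.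

Lemma leq_mT T x : (T x <= mT T)%N.
Proof. exact: (mT_leP T _ (leqnn _)). Qed.

Lemma mT_lt T : (mT T < Bnd d la)%N.
Proof. by rewrite ltnS; apply/mT_leP => x; rewrite -ltnS. Qed.

Lemma sitP M T :
  reflect [/\ forall x, (0 < T x)%N = (x \in lam) && (x \notin M),
      forall x y, below x y -> x != y -> x \notin M -> y \in lam -> (T x < T y)%N &
      forall k, (0 < k <= mT T)%N -> exists x, (T x : nat) = k] (sit M T).
Proof.
apply: (iffP and3P) => -[h1 h2 h3]; split.
- by move=> x; exact: (eqP (forallP h1 x)).
- move=> x y bxy nxy xM yl; move/forallP/(_ x)/forallP/(_ y)/implyP: h2; apply.
  by rewrite bxy nxy xM.
- move=> k hk; have lt_k : (k < Bnd d la)%N.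
    by case/andP: hk => _ /leq_ltn_trans; apply; apply: mT_lt.
  move/forallP/(_ (Ordinal lt_k))/implyP: h3 => /(_ hk)/existsP[x /eqP e].
  by exists x.
- by apply/forallP => x; apply/eqP.
- by apply/forallP => x; apply/forallP => y; apply/implyP => /and4P[]; apply: h2.
- apply/forallP=> k; apply/implyP => /h3[x e]; apply/existsP; exists x; exact/eqP.
Qed.

(** Strictness along rows and columns gives strictness along [below]: compare through the corner
    [(x.1, y.2)], which again lies in the skew shape. *)
Lemma is_SIT_sit mu T : is_partition mu -> is_SIT mu T = sit (diag_set d la mu) T.
Proof.
move=> mu_part.
have skE x : in_skew la mu (cellpos x) = (x \in lam) && (x \notin diag_set d la mu).
  by rewrite /in_skew !inE.
have imu := ideal_diag (d := d) (la := la) mu_part; have ila := ideal_diag (d := d) (la := la) la_part.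
apply/and4P/sitP => [[h1 h2 h3 h4]|[h1 h2 h3]].
  have pos x : (0 < T x)%N = (x \in lam) && (x \notin diag_set d la mu).
    move/forallP/(_ x): h1; rewrite skE; case: ((x \in lam) && _) => /=; first by rewrite andbT.
    by move=> /eqP->.
  have row x y : (x.1 : nat) = y.1 -> (x.2 < y.2)%N -> x \notin diag_set d la mu ->
      y \in lam -> (T x < T y)%N.
    move=> e lt xM yl; move/forallP/(_ x)/forallP/(_ y)/implyP: h2; apply.
    have xl : x \in lam by apply: (ila _ y) => //; rewrite /below; lia.
    have yM : y \notin diag_set d la mu by apply: contra xM; apply: imu; rewrite /below; lia.
    by rewrite !skE xl yl xM yM /= ltnS eqSS e eqxx.
  have col x y : (x.2 : nat) = y.2 -> (x.1 < y.1)%N -> x \notin diag_set d la mu ->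
      y \in lam -> (T x < T y)%N.
    move=> e lt xM yl; move/forallP/(_ x)/forallP/(_ y)/implyP: h3; apply.
    have xl : x \in lam by apply: (ila _ y) => //; rewrite /below; lia.
    have yM : y \notin diag_set d la mu by apply: contra xM; apply: imu; rewrite /below; lia.
    by rewrite !skE xl yl xM yM /= ltnS eqSS e eqxx.
  split=> //.
    move=> x y /andP[b1 b2] nxy xM yl; pose w : cell := (x.1, y.2).
    have [e2|n2] := eqVneq (x.2 : nat) y.2.
      apply: col => //; rewrite ltn_neqAle b1 andbT; apply: contra nxy => /eqP e1.
      exact/cellP.
    have lt2 : (x.2 < y.2)%N by rewrite ltn_neqAle n2.
    have [e1|n1] := eqVneq (x.1 : nat) y.1; first exact: row.
    have lt1 : (x.1 < y.1)%N by rewrite ltn_neqAle n1.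
    have wl : w \in lam by apply: (ila _ y) => //; rewrite /below /= b1 leqnn.
    have wM : w \notin diag_set d la mu.
      by apply: contra xM; apply: imu; rewrite /below /= leqnn b2.
    by apply: (@ltn_trans (T w)); [apply: row|apply: col].
  move=> k hk; have lt_k : (k < Bnd d la)%N.
    by case/andP: hk => _ /leq_ltn_trans; apply; apply: mT_lt.
  move/forallP/(_ (Ordinal lt_k))/implyP: h4 => /(_ hk)/existsP[x /andP[_ /eqP e]].
  by exists x; rewrite e.
split.
- apply/forallP=> x; rewrite skE -h1; case: (T x) => -[|m] hm //=.
- apply/forallP=> x; apply/forallP=> y; apply/implyP; rewrite !skE /= ltnS eqSS.
  case/and4P=> /andP[_ xM] /andP[yl _] /eqP e lt.
  by apply: h2 => //; [rewrite /below; lia|apply/cellP; lia].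
- apply/forallP=> x; apply/forallP=> y; apply/implyP; rewrite !skE /= ltnS eqSS.
  case/and4P=> /andP[_ xM] /andP[yl _] /eqP e lt.
  by apply: h2 => //; [rewrite /below; lia|apply/cellP; lia].
- apply/forallP=> k; apply/implyP=> hk; have [x e] := h3 _ hk.
  apply/existsP; exists x; rewrite skE -h1 e; case/andP: hk => -> _ /=; exact/eqP/val_inj.
Qed.

(** Cells of entry 1 receive the dummy value 0 and so join the inner shape. *)
Definition tab_pred T : Tab d la := [ffun x => inord (T x).-1].

Definition tab_succ M T : Tab d la :=
  [ffun x => if (x \in lam) && (x \notin M) then inord (T x).+1 else ord0].

Lemma tab_predE T x : (tab_pred T x : nat) = (T x).-1.
Proof. by rewrite ffunE inordK // (leq_ltn_trans (leq_pred _)). Qed.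

Lemma mT_pred T : mT (tab_pred T) = (mT T).-1.
Proof.
apply/eqP; rewrite eqn_leq; apply/andP; split.
  apply/mT_leP => x; rewrite tab_predE -!subn1 leq_sub2r //; exact: leq_mT.
suff : (mT T <= (mT (tab_pred T)).+1)%N by lia.
apply/mT_leP => x; rewrite (leq_trans (leqSpred _)) // ltnS -tab_predE.
exact: leq_mT.
Qed.

Lemma sublevel1 M T : M \subset lam -> sit M T -> sublevel T 1 = M.
Proof.
move=> /subsetP sM /sitP[h1 _ _]; apply/setP=> x; rewrite mem_sublevel ltnS leqn0 -[_ == _]negbK -lt0n h1.
by have := sM x; case: (x \in M); case: (x \in lam) => //= /(_ isT).
Qed.

Lemma sublevel_pred T k : (0 < k)%N -> sublevel (tab_pred T) k = sublevel T k.+1.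
Proof.
by move=> k0; apply/setP=> x; rewrite !mem_sublevel tab_predE; case: (T x : nat) => [|m] //=; rewrite k0.
Qed.

Lemma sit_pred M T : sit M T -> sit (sublevel T 2) (tab_pred T).
Proof.
move=> /sitP[h1 h2 h3]; apply/sitP; split.
- move=> x; rewrite tab_predE mem_sublevel; have := h1 x.
  by case: (x \in lam); case: (T x : nat) => [|[|m]] //=.
- move=> x y bxy nxy; rewrite !tab_predE mem_sublevel => hx yl.
  have xl : x \in lam by apply: (ideal_diag la_part) bxy yl.
  move: hx; rewrite xl /= -leqNgt => Tx.
  have := h2 x y bxy nxy; have := h1 x; rewrite (ltnW Tx) xl => /esym/= -> /(_ isT yl).
  by lia.
- move=> k; rewrite mT_pred => hk; have [|x e] := h3 k.+1; first by case: (mT T) hk => [|m]; case/andP; case: k.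
  by exists x; rewrite tab_predE e.
Qed.

Lemma tab_predK M T : sit M T -> tab_succ M (tab_pred T) = T.
Proof.
move=> /sitP[h1 _ _]; apply/ffunP=> x; apply: val_inj; rewrite /= ffunE -h1.
case: (posnP (T x)) => [->//|Tx]; rewrite inordK tab_predE prednK //.
Qed.

(** A cell strictly below an entry 1 and outside [M] would need a smaller positive entry, so entries
    1 sit on addable cells. One occurs because some cell of [lam] is outside [M]. *)
Lemma sublevel2_rook M T : ideal M -> M \subset lam -> M != lam -> sit M T ->
  [&& rook M (sublevel T 2), sublevel T 2 \subset lam & sublevel T 2 != M].
Proof.
move=> iM sM nM hT; have /sitP[h1 h2 h3] := hT.
have s1 := sublevel1 sM hT.
apply/and3P; split; last 2 first.
- by apply/subsetP=> x; rewrite mem_sublevel => /andP[].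
- have [x0 xl0 xM0] : exists2 x, x \in lam & x \notin M.
    by apply/subsetPn; apply: contra nM => sl; rewrite eqEsubset sM.
  have m0 : (0 < mT T)%N.
    by apply: leq_trans (leq_mT T x0); rewrite h1 xl0.
  have [x e] := h3 1%N m0; apply/eqP=> /setP/(_ x); rewrite mem_sublevel e.
  by have := h1 x; rewrite e; case: (x \in lam); case: (x \in M).
apply/andP; split.
  by rewrite -{1}s1; apply/subsetP=> x; rewrite !mem_sublevel => /andP[-> /=]; lia.
apply/subsetP=> x; rewrite mem_sublevel => /andP[xl Tx]; rewrite !inE.
have [//|xM] := boolP (x \in M); apply/addableP; split=> // y byx nyx.
apply: contraT => yM; have yl : y \in lam by apply: (ideal_diag la_part) byx xl.
have Ty : (0 < T y)%N by rewrite h1 yl yM.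
by have := leq_ltn_trans Ty (h2 _ _ byx nyx yM xl); rewrite ltnNge -ltnS Tx.
Qed.

Lemma tab_succP M M' T : ideal M -> M \subset lam -> rook M M' -> M' \subset lam ->
  M' != M -> sit M' T ->
  [/\ sit M (tab_succ M T), sublevel (tab_succ M T) 2 = M'
    & tab_pred (tab_succ M T) = T].
Proof.
move=> iM sM rM sM' nM' /sitP[h1 h2 h3]; have /andP[sMM' sMa] := rM.
have ila := ideal_diag (d := d) (la := la) la_part.
have T0 x : x \in M' -> (T x : nat) = 0%N.
  by move=> xM'; apply/eqP; rewrite -leqn0 leqNgt h1 xM' andbF.
have [w wM' wM] : exists2 x, x \in M' & x \notin M.
  by apply/subsetPn; apply: contra nM' => sl; rewrite eqEsubset sl sMM'.
(* The raised entries must fit the bounded type, or [inord] would lose them. If the bound were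
   reached, [T] would take every value from 0 (at [w]) to the number of cells, which is one value
   too many. *)
have bound x : ((T x).+1 < Bnd d la)%N.
  rewrite ltnNge; apply/negP=> hx.
  have hm : mT T = #|{: Cell d la}|.
    by apply/eqP; rewrite eqn_leq -ltnS mT_lt; apply: leq_trans (leq_mT T x).
  have surj : [set: 'I_(Bnd d la)] \subset [set T x | x in [set: cell]].
    apply/subsetP=> k _; apply/imsetP; have [k0|k0] := posnP k.
      by exists w => //; apply: val_inj; rewrite /= T0.
    have [|y e] := h3 k; first by rewrite k0 hm -ltnS (ltn_ord k).
    by exists y => //; apply: val_inj.
  have := leq_trans (subset_leq_card surj) (leq_imset_card _ _).
  by rewrite !cardsT card_ord ltnn.
have sE x : (tab_succ M T x : nat) = if (x \in lam) && (x \notin M) then (T x).+1 else 0%N.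
  by rewrite ffunE; case: ifP => // _; rewrite inordK.
have Tpos x : (0 < T x)%N -> [/\ x \in lam, x \notin M' & x \notin M].
  by rewrite h1 => /andP[xl xM']; split=> //; apply: contra xM'; apply: (subsetP sMM').
split.
- apply/sitP; split.
  + by move=> x; rewrite sE; case: ifP.
  + move=> x y bxy nxy xM yl; have xl := ila _ _ bxy yl.
    have yM : y \notin M by apply: contra xM; apply: iM.
    rewrite !sE xl yl xM yM /= ltnS; have [xM'|xM'] := boolP (x \in M'); last exact: h2.
    rewrite (T0 x xM') h1 yl /=; apply/negP=> /(subsetP sMa); rewrite !inE (negPf yM) /=.
    by move=> /addableP[_ /(_ _ bxy nxy)]; rewrite (negPf xM).
  + have mle : (mT (tab_succ M T) <= (mT T).+1)%N.
      by apply/mT_leP => x; rewrite sE; case: ifP => // _; rewrite ltnS leq_mT.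
    case=> [|[|k]] // hk.
      by exists w; rewrite sE wM (subsetP sM') // T0.
    have [|x e] := h3 k.+1; first by rewrite /= -ltnS (leq_trans _ mle).
    have [|xl _ xM] := Tpos x; first by rewrite e.
    by exists x; rewrite sE xl xM e.
- apply/setP=> x; rewrite mem_sublevel sE; apply/andP/idP => [[xl]|xM'].
    apply: contraTT => xM'; have [|_ _ xM] := Tpos x; first by rewrite h1 xl.
    by rewrite xl xM /= ltnS -ltnNge ltnS h1 xl.
  by rewrite (subsetP sM') // T0 //; case: ifP.
- apply/ffunP=> x; apply: val_inj; rewrite /= tab_predE sE.
  case: ifP => // nx; apply/esym/eqP; rewrite -[_ == _]negbK -lt0n.
  by apply/negP=> /Tpos[xl _ xM]; rewrite xl xM in nx.
Qed.

Variables (F : fieldType) (G : {set cell} -> F).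

Definition sit_sum M : F :=
  \sum_(T : Tab d la | sit M T) \prod_(1 <= k < (mT T).+1) G (sublevel T k).

Lemma sit_sum_full : sit_sum lam = 1.
Proof.
rewrite /sit_sum (big_pred1 [ffun=> ord0]) => [|T].
  have -> : mT ([ffun=> ord0] : Tab d la) = 0%N.
    by apply/eqP; rewrite -leqn0; apply/mT_leP => x; rewrite ffunE.
  by rewrite big_geq.
apply/sitP/eqP => [[h1 _ _]|->].
  apply/ffunP=> x; apply: val_inj; rewrite /= ffunE /=; have := h1 x.
  by rewrite andbN lt0n => /negbFE/eqP.
split=> [x|x y bxy _ /negP xl yl|k].
- by rewrite ffunE andbN.
- by case: xl; apply: (ideal_diag la_part) bxy yl.
- move=> /andP[k0 km]; have : (mT ([ffun=> ord0] : Tab d la) <= 0)%N.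
    by apply/mT_leP => x; rewrite ffunE.
  by move/(leq_trans km); rewrite leqNgt k0.
Qed.

(** Tableaux are sorted by their cells of entry 1. The factor for k = 1 is [G M], and the others are
    the factors of the lowered tableau. *)
Lemma sit_sum_rec M : ideal M -> M \subset lam -> M != lam ->
  sit_sum M = G M *
    \sum_(M' | [&& rook M M', M' \subset lam & M' != M]) sit_sum M'.
Proof.
move=> iM sM nM; rewrite {1}/sit_sum.
rewrite (partition_big (fun T => sublevel T 2)
  (fun M' => [&& rook M M', M' \subset lam & M' != M])); last first.
  by move=> T; apply: sublevel2_rook.
rewrite mulr_sumr; apply: eq_bigr => M' /and3P[rM sM' nM'].
rewrite (reindex_onto (tab_succ M) tab_pred) /=; last first.
  by move=> T /andP[hT _]; apply: tab_predK.
rewrite /sit_sum mulr_sumr; apply: eq_big => [T|T /andP[/andP[hT _] /eqP eT]].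
  apply/andP/idP => [[/andP[hT /eqP <-] /eqP eT]|hT].
    by rewrite -{2}eT; apply: sit_pred hT.
  by have [-> -> ->] := tab_succP iM sM rM sM' nM' hT; rewrite !eqxx.
set S := tab_succ M T in hT eT *; rewrite -[in RHS]eT mT_pred.
have m0 : (0 < mT S)%N.
  have /subsetPn[x xl xM] : ~~ (lam \subset M).
    by apply: contra nM => sl; rewrite eqEsubset sM.
  case/sitP: hT => h1 _ _; apply: leq_trans (leq_mT S x).
  by rewrite h1 xl xM.
rewrite prednK // big_ltn // (sublevel1 sM hT); congr (_ * _).
rewrite big_add1 /=; apply: eq_big_nat => k /andP[k0 _].
by rewrite sublevel_pred.
Qed.

End IncreasingTableaux.

(** * Comparison of the two recursions on the subideals of [lam] *)

Section Shape.
Variables (d : nat) (la : seq nat).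
Hypothesis la_part : is_partition la.
Notation cell := ('I_d * 'I_(part la 1))%type.
Notation lam := (diag_set d la la).
Implicit Types (x y z : cell) (M D : {set cell}).

Lemma card_row M i : #|[set x in M | x.1 == i]| = rowlen M i.
Proof.
have inj : injective (fun j : 'I_(part la 1) => (i, j)) by move=> j j' [].
rewrite /rowlen -(card_imset _ inj); apply: eq_card => -[a j]; rewrite inE /=.
apply/andP/imsetP => [[aM /eqP ea]|[b]]; first by exists j; rewrite ?inE -?ea.
by rewrite inE => bM [-> ->].
Qed.

Lemma rowlen_lam (i : 'I_d) : rowlen lam i = part la i.+1.
Proof.
rewrite -[RHS](@card_ord_lt (part la 1)); last exact: part_anti.
by apply: eq_card => j; rewrite [LHS]inE mem_diag inE.
Qed.

Lemma collen_lam (j : 'I_(part la 1)) : (size la <= d)%N ->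
  collen lam j = conj_part la j.+1.
Proof.
move=> le_d; rewrite /conj_part -sum1_count (big_nth 0%N) big_mkord.
rewrite (big_ord_widen_cond d (fun i => j < nth 0 la i)%N (fun=> 1%N)) // sum1dep_card.
apply: eq_card => i; rewrite !inE /=; apply/idP/andP => [h|[]//]; split=> //.
rewrite ltnNge; apply/negP=> hi; move: h.
by rewrite /in_diag /part /= nth_default.
Qed.

Lemma card_lam : (size la <= d)%N -> #|lam| = psize la.
Proof.
move=> le_d; rewrite /psize sumnE (big_nth 0%N) big_mkord.
rewrite (big_ord_widen d (nth 0%N la)) // -sum1_card.
rewrite (partition_big (fun x : cell => x.1) predT) //= big_mkcond [RHS]big_mkcond /=.
apply: eq_bigr => i _; rewrite sum1dep_card.
have -> : #|[set x | (x \in lam) && (x.1 == i)]| = part la i.+1.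
  by rewrite -rowlen_lam -card_row; apply: eq_card => x; rewrite !inE.
by case: ifP => // /negbT; rewrite -leqNgt /part /= => h; rewrite nth_default.
Qed.

Lemma connect_full D : connect (@exc_move d la) lam D = (D == lam).
Proof.
apply/connectP/eqP => [[[|S s] /= h ->//]|->]; last by exists [::].
case/andP: h => /(exc_moveP la_part)[x [y [u [l [_ _ [yS _ _] yl _]]]]].
by rewrite yl in yS.
Qed.

Variables (F : fieldType) (c : nat -> F).
Let p (x : cell) : F := c (colpos lam x.2) / c (rowpos lam x.1) - 1.
Hypothesis c_row : forall i, c (rowpos lam i) != 0.
Hypothesis p_neq0 : forall x, x \in lam -> p x != 0.
Hypothesis weight_neq : forall M, ideal M -> M \subset lam -> M != lam ->
  weight c M != weight c lam.

Lemma hecke_sum_sub M : ~~ (M \subset lam) -> hecke_sum p lam M = 0.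
Proof.
move=> nsM; apply: big1 => D sD; case: eqP => [hD|_]; last by rewrite mul0r.
by have [_ sM] := hecke_connect la_part sD hD; rewrite sM in nsM.
Qed.

Lemma weight_lam : weight c lam = \prod_i c (rowpos lam i). Proof. by []. Qed.

(** The Chevalley rule with the term [M' = M] moved to the left; the strips leaving [lam] drop out
    by [hecke_sum_sub]. *)
Lemma hecke_sum_rec M : ideal M -> M \subset lam -> M != lam ->
  hecke_sum p lam M = (weight c M / weight c lam - 1)^-1 *
    \sum_(M' | [&& rook M M', M' \subset lam & M' != M]) hecke_sum p lam M'.
Proof.
move=> iM sM nM; have w0 : weight c lam != 0 by apply/prodf_neq0 => i _.
have w1 : weight c M / weight c lam - 1 != 0.
  by rewrite subr_eq0 -(inj_eq (mulIf w0)) divfK // mul1r weight_neq.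
apply: (mulfI w1); rewrite mulrA divff // mul1r.
have := @chevalley F d (part la 1) _ _ lam c M c_row (ideal_diag la_part)
  (fun=> erefl) (fun=> erefl) iM.
rewrite /= -/p -weight_lam => eq_w.
rewrite mulrBl mul1r mulrAC eq_w mulrAC divff // mul1r /rook_sum.
rewrite (bigD1 M) /=; last by rewrite /rook subxx subsetUl.
rewrite addrAC subrr add0r (bigID (fun M' : {set cell} => M' \subset lam)) /=.
rewrite [X in _ + X]big1 ?addr0 => [|M' /andP[_ ]]; last exact: hecke_sum_sub.
by apply: eq_bigl => M'; rewrite -andbA [(_ != _) && _]andbC.
Qed.

(** Both sides obey the same recursion. At [lam] only the full set has value [lam], so the
    coefficient there is the product of all [p x]; this fixes the normalisation. *)
Lemma sit_sum_hecke M : ideal M -> M \subset lam ->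
  sit_sum (fun U => (weight c U / weight c lam - 1)^-1) M =
  (\prod_(x in lam) p x)^-1 * hecke_sum p lam M.
Proof.
have [n] := ubnP #|lam :\: M|; elim: n => // n IH in M * => hn iM sM.
have [->|nM] := eqVneq M lam.
  rewrite sit_sum_full // /hecke_sum (bigD1 lam) //= [X in _ + X]big1 => [|D /andP[sD nD]].
    rewrite hecke_id; last exact: ideal_diag.
    by rewrite eqxx mul1r addr0 mulVf //; apply/prodf_neq0.
  have := connect_full D; rewrite (connect_exc la_part) //; last exact: ideal_diag.
  by rewrite sD (negPf nD) /= => ->; rewrite mul0r.
rewrite sit_sum_rec // hecke_sum_rec // [RHS]mulrCA; congr (_ * _).
rewrite mulr_sumr; apply: eq_bigr => M' /and3P[rM sM' nM'].
apply: IH => //; last exact: rook_ideal rM.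
rewrite ltnS in hn; apply: leq_trans hn; apply: proper_card.
case/andP: rM => sMM' _; rewrite properE setDS //=.
have [x xM' xM] : exists2 x, x \in M' & x \notin M.
  by apply/subsetPn; apply: contra nM' => s; rewrite eqEsubset s.
apply/subsetPn; exists x; rewrite in_setD.
  by rewrite xM (subsetP sM').
by rewrite xM'.
Qed.

Lemma sit_sum_excited M : ideal M -> M \subset lam ->
  sit_sum (fun U => (weight c U / weight c lam - 1)^-1) M =
  \sum_(D | connect (@exc_move d la) M D) \prod_(x in lam :\: D) (p x)^-1.
Proof.
move=> iM sM; rewrite sit_sum_hecke // /hecke_sum mulr_sumr.
rewrite (bigID (fun D => hecke D == Some M)) /= [X in _ + X]big1 ?addr0; last first.
  by move=> D /andP[_ /negPf->]; rewrite mul0r mulr0.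
apply: eq_big => [D|D /andP[sD ->]]; first by rewrite connect_exc.
rewrite mul1r (big_setID D) /= (setIidPr sD) invfM mulrAC mulVf ?mul1r.
  by rewrite prodfV.
by apply/prodf_neq0 => x xD; apply: p_neq0; apply: (subsetP sD).
Qed.

End Shape.

(** * Non-vanishing in the field of rational functions *)

Section Genericity.
Variable n : nat.
Hypothesis n0 : (0 < n)%N.

(** The point beta = 1, y_k = k. There [cpoly m] takes the value m + 2, positive and strictly
    increasing in m, which separates everything that must differ. *)
Definition valuation (i : 'I_n) : rat := if (i : nat) is m.+1 then m.+1%:R else 1.

Lemma tofrac_neq (f g : {mpoly rat[n]}) :
  f.@[valuation] != g.@[valuation] -> tofrac f != tofrac g.
Proof. by apply: contraNneq => /eqP; rewrite tofrac_eq => /eqP->. Qed.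

Lemma eval_var k : (0 < k < n)%N -> (var n k).@[valuation] = k%:R.
Proof.
case/andP=> k0 kn; rewrite /var insubT mevalXU /valuation /=.
by case: k k0 kn.
Qed.

Lemma eval_beta : (var n 0).@[valuation] = 1.
Proof. by rewrite /var insubT mevalXU. Qed.

Definition cpoly (m : nat) : {mpoly rat[n]} := 1 + var n 0 * var n m.+1.
Definition cval (m : nat) : RF n := 1 + betav n * yv n m.+1.

Lemma cvalE m : cval m = tofrac (cpoly m).
Proof. by rewrite /cval /cpoly tofracD tofracM tofrac1. Qed.

Lemma eval_cpoly m : (m.+1 < n)%N -> (cpoly m).@[valuation] = m.+2%:R.
Proof.
by move=> mn; rewrite /cpoly mevalD mevalM meval1 eval_beta eval_var // mul1r nat1r.
Qed.

Lemma cval_neq0 m : (m.+1 < n)%N -> cval m != 0.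
Proof. by move=> mn; rewrite cvalE -tofrac0 tofrac_neq // eval_cpoly // meval0 pnatr_eq0. Qed.

Lemma cval_neq m m' : (m < m')%N -> (m'.+1 < n)%N -> cval m != cval m'.
Proof.
move=> lt mn; rewrite !cvalE tofrac_neq // !eval_cpoly //; last by lia.
by rewrite eqr_nat; lia.
Qed.

Lemma prod_cval_neq d (a b : 'I_d -> nat) i :
  (forall i, (a i <= b i)%N) -> (a i < b i)%N -> (forall i, ((b i).+1 < n)%N) ->
  \prod_i cval (a i) != \prod_i cval (b i).
Proof.
move=> le_ab lt_ab bn; have prodE (e : 'I_d -> nat) :
    \prod_i cval (e i) = tofrac (\prod_i cpoly (e i)).
  by rewrite rmorph_prod; apply: eq_bigr => j _; rewrite cvalE.
have evE (e : 'I_d -> nat) : (forall i, ((e i).+1 < n)%N) ->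
    (\prod_i cpoly (e i)).@[valuation] = (\prod_i (e i).+2)%N%:R.
  move=> en; rewrite rmorph_prod natr_prod; apply: eq_bigr => j _.
  exact: eval_cpoly.
rewrite !prodE tofrac_neq // !evE //; last by move=> j; rewrite (leq_ltn_trans _ (bn j)) // ltnS.
rewrite eqr_nat ltn_eqF // (bigD1 i) //= [X in (_ < X)%N](bigD1 i) //=.
apply: (@leq_ltn_trans ((a i).+2 * \prod_(j < d | j != i) (b j).+2)).
  by rewrite leq_mul2l /= leq_prod // => j _; rewrite !ltnS.
by rewrite ltn_pmul2r ?prodn_gt0 // !ltnS.
Qed.

End Genericity.

(** * Translation to the notation of the theorem *)

Section Assembly.
Variables (d : nat) (la : seq nat).
Hypothesis la_part : is_partition la.
Notation cell := ('I_d * 'I_(part la 1))%type.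
Notation lam := (diag_set d la la).

Lemma rowpos_lam (i : 'I_d) : (rowpos lam i).+1 = (part la i.+1 + d + 1 - i.+1)%N.
Proof. by rewrite /rowpos rowlen_lam //; have := ltn_ord i; lia. Qed.

Lemma rowpos_lt_n n (i : 'I_d) : (part la 1 + d < n)%N -> ((rowpos lam i).+1 < n)%N.
Proof.
move=> lt_n; apply: leq_ltn_trans lt_n; rewrite rowpos_lam.
by have := part_anti la_part (leq0n i); lia.
Qed.

Lemma colpos_lam (j : 'I_(part la 1)) : (size la <= d)%N ->
  (colpos lam j).+1 = (d + j.+1 - conj_part la j.+1)%N.
Proof.
by move=> le_size; rewrite /colpos -(@collen_lam d) //; have := collen_le lam j; lia.
Qed.

(** The difference of the two positions is the hook length of [x]. *)
Lemma colpos_lt_rowpos (x : cell) : x \in lam -> (colpos lam x.2 < rowpos lam x.1)%N.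
Proof.
move=> xl; have il := ideal_diag (d := d) (la := la) la_part.
have := mem_rowlen x il; have := mem_collen x il; rewrite xl /colpos /rowpos.
by have := ltn_ord x.1; have := collen_le lam x.2; lia.
Qed.

Lemma weight_cval_neq n (M : {set cell}) : (part la 1 + d < n)%N -> ideal M -> M \subset lam -> M != lam ->
  weight (cval n) M != weight (cval n) lam.
Proof.
move=> lt_n iM sM nM; have il := ideal_diag (d := d) (la := la) la_part.
have /subsetPn[x xl xM] : ~~ (lam \subset M).
  by apply: contra nM => sl; rewrite eqEsubset sM.
have le_row i : (rowpos M i <= rowpos lam i)%N.
  rewrite leq_add2r; apply/subset_leq_card/subsetP => j; rewrite !inE => jM.
  by have := subsetP sM _ jM; rewrite inE.
have n0 : (0 < n)%N by apply: leq_ltn_trans lt_n.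
apply: (@prod_cval_neq n n0 d _ _ x.1) => //; last first.
  by move=> i; apply: rowpos_lt_n.
rewrite /rowpos ltn_add2r; have := mem_rowlen x il; have := mem_rowlen x iM.
by rewrite xl (negPf xM) => /esym/negbT; rewrite -leqNgt => h /esym; apply: leq_ltn_trans.
Qed.

Lemma nuT_rowlen mu (T : Tab d la) k (i : 'I_d) :
  is_partition mu -> subpart mu la -> is_SIT mu T -> (0 < k)%N ->
  nuT mu T k i.+1 = rowlen (sublevel T k) i.
Proof.
move=> mu_part mu_la; rewrite (is_SIT_sit la_part) // => /sitP[h1 _ _] k0; rewrite -card_row.
apply: eq_card => x; rewrite !inE andbC eqSS; congr (_ && _).
have sml : in_diag mu (cellpos x) -> in_diag la (cellpos x).
  by rewrite /in_diag /= => h; apply: leq_trans h (mu_la _).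
have := h1 x; rewrite /in_skew !inE; case: (in_diag mu _) sml => [/(_ isT)->|_] /=.
  by rewrite lt0n => /negbFE/eqP->.
by rewrite andbT.
Qed.

End Assembly.

Theorem theorem6p5 (d : nat) (la mu : seq nat) (n : nat) :
  (1 <= d)%N ->
  is_partition la -> is_partition mu -> subpart mu la ->
  (size la <= d)%N ->
  (part la 1 + d < n)%N ->
  \sum_(T : Tab d la | is_SIT mu T)
     \prod_(1 <= k < (mT T).+1)
       ((\prod_(1 <= i < d.+1)
           ((1 + betav n * yv n (nuT mu T k i + d + 1 - i)) /
            (1 + betav n * yv n (part la i + d + 1 - i)))) - 1)^-1
  =
  \sum_(D in excited d la mu)
     betav n ^ ((#|D| : int) - (psize la : int)) *
     \prod_(x : Cell d la | in_diag la (cellpos x) && (x \notin D))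
       ((betav n * yv n (part la (cellpos x).1 + d + 1 - (cellpos x).1) + 1) /
        (yv n (d + (cellpos x).2 - conj_part la (cellpos x).2)
           - yv n (part la (cellpos x).1 + d + 1 - (cellpos x).1))).
Proof.
move=> _ la_part mu_part mu_la le_size lt_n.
have n0 : (0 < n)%N by apply: leq_ltn_trans lt_n.
have rowposE (i : 'I_d) := rowpos_lam la_part i.
have row_n (i : 'I_d) := rowpos_lt_n la_part i lt_n.
have imu := ideal_diag (d := d) (la := la) mu_part.
have smu : diag_set d la mu \subset (diag_set d la la).
  by apply/subsetP=> x; rewrite !mem_diag => h; apply: leq_trans h (mu_la _).
have c_row (i : 'I_d) : cval n (rowpos (diag_set d la la) i) != 0.
  exact: (cval_neq0 n0 (row_n i)).
pose p (x : 'I_d * 'I_(part la 1)) := cval n (colpos (diag_set d la la) x.2) / cval n (rowpos (diag_set d la la) x.1) - 1.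
have pE x : p x = betav n * (yv n (colpos (diag_set d la la) x.2).+1 - yv n (rowpos (diag_set d la la) x.1).+1)
                  / cval n (rowpos (diag_set d la la) x.1).
  rewrite /p -[X in _ - X](divff (c_row x.1)) -mulrBl; congr (_ / _).
  by rewrite /cval mulrBr opprD addrACA subrr add0r.
have p0 x : x \in (diag_set d la la) -> p x != 0.
  move=> xl; rewrite /p subr_eq0 -(inj_eq (mulIf (c_row x.1))) divfK // mul1r.
  exact: (cval_neq n0 (colpos_lt_rowpos la_part xl) (row_n _)).
transitivity (sit_sum (fun U => (weight (cval n) U / weight (cval n) (diag_set d la la) - 1)^-1)
    (diag_set d la mu)).
  rewrite /sit_sum; apply: eq_big => [T|T hT]; first exact: (is_SIT_sit la_part T mu_part).
  apply: eq_big_nat => k /andP[k0 _]; congr (_ - _)^-1.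
  rewrite big_add1 big_mkord /weight -prodf_div; apply: eq_bigr => i _ /=.
  rewrite (nuT_rowlen la_part) // /cval -rowposE; congr ((1 + _ * yv n _) / _).
  have hi : (i.+1 <= d)%N by apply: ltn_ord.
  by rewrite /rowpos -addnA addn1 -addnBA ?subSn ?addnS // (leq_trans hi).
rewrite (sit_sum_excited la_part) //; last by move=> M; apply: (weight_cval_neq la_part lt_n).
apply: eq_big => [D|D cD]; first by rewrite inE.
have sD : D \subset (diag_set d la la) by move: cD; rewrite (connect_exc la_part) // => /andP[].
(* The power of beta supplies one inverse of beta for each cell of [lam] outside [D], matching the
   factor beta in [pE]. *)
have -> : (#|D| : int) - (psize la : int) = - (#|(diag_set d la la) :\: D| : int).
  rewrite -(card_lam la_part le_size) -(cardsID D (diag_set d la la)) (setIidPr sD) PoszD opprD addrA subrr.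
  by rewrite add0r.
rewrite -invr_expz -exprVn.
transitivity (\prod_(x in (diag_set d la la) :\: D) ((betav n)^-1 *
   (cval n (rowpos (diag_set d la la) x.1) / (yv n (colpos (diag_set d la la) x.2).+1 - yv n (rowpos (diag_set d la la) x.1).+1)))).
  by apply: eq_bigr => x _; rewrite -/(p x) pE !invfM invrK mulrAC mulrA.
rewrite big_split /= prodr_const; congr (_ * _).
apply: eq_big => [x|x _]; first by rewrite !inE andbC.
by rewrite /cval -rowposE -(colpos_lam la_part _ le_size) addrC.
Qed.
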